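(* Let $\sigma,\rho\ge 0$ and $\nu>0$. The capacity $C$ of an AWGN channel with $(\sigma,\rho)$-power constraints and noise power $\nu$ satisfies $$\frac12\log\left(1+\frac{e^{2v(\sigma,\rho)}}{2\pi e\nu}\right)\le C\le \frac12\log\left(1+\frac{\rho}{\nu}\right).$$
   Context: All logarithms are natural and rates are in nats; $\log 0=-\infty$, $e^{-\infty}=0$. $\mathcal S_n(\sigma,\rho)=\{x^n\in\mathbb R^n:\ \sum_{j=k+1}^{l}x_j^2\le \sigma+(l-k)\rho\ \text{ for all } 0\le k<l\le n\}$, and $v(\sigma,\rho):=\lim_{n\to\infty}\frac1n\log \mathrm{Vol}(\mathcal S_n(\sigma,\rho))$ (the limit exists in $[-\infty,\infty)$), where $\mathrm{Vol}$ is $n$-dimensional Lebesgue measure. AWGN channel with noise power $\nu$: input $X_i$, output $Y_i=X_i+Z_i$, where $Z_1,Z_2,\dots$ are i.i.d. $\mathcal N(0,\nu)$ independent of the input. A code of block length $n$ and rate $R$ for the $(\sigma,\rho)$-power constraint consists of a message set $\{1,\dots,\lfloor e^{nR}\rfloor\}$, an encoder mapping messages into $\mathcal S_n(\sigma,\rho)$, and a decoder mapping $\mathbb R^n$ to messages. A rate $R$ is achievable if there is a sequence of such codes ($n\to\infty$) whose probability of decoding error (for a uniformly distributed message) tends to $0$. The capacity $C$ is the supremum of achievable rates. *)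

(* Defs.v *)
From HB Require Import structures.
From mathcomp Require Import all_boot all_order all_algebra finmap.
From mathcomp Require Import all_classical all_reals all_analysis.
Set Implicit Arguments.
Unset Strict Implicit.
Unset Printing Implicit Defensive.
Import Order.TTheory GRing.Theory Num.Theory.
Import numFieldNormedType.Exports.
Local Open Scope classical_set_scope.
Local Open Scope ring_scope.

Section cons_measure.
Context {R : realType} (n : nat).
Local Open Scope ereal_scope.
Local Notation T := (measurableTypeR R).

Definition cons_pair (p : T * n.-tuple T) : n.+1.-tuple T :=
  [tuple of p.1 :: p.2].

Let uncons (t : n.+1.-tuple T) : T * n.-tuple T :=
  (thead t, [tuple of behead t]).

Let measurable_cons_pair : measurable_fun setT cons_pair.
Proof. exact: measurable_cons. Qed.

Let measurable_uncons : measurable_fun setT uncons.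
Proof.
apply: measurable_fun_pair; last exact: measurable_behead.
exact: (measurable_tnth ord0).
Qed.

Let cons_pairK : cancel cons_pair uncons.
Proof.
by move=> [x t]; rewrite /uncons theadE; congr pair; exact: val_inj.
Qed.

Definition cons_measure (mu : set (n.-tuple T) -> \bar R) :
    set (n.+1.-tuple T) -> \bar R :=
  pushforward (lebesgue_measure \x mu) cons_pair.

Variable mu : {sigma_finite_measure set (n.-tuple T) -> \bar R}.

Let measurable_preimage_cons A :
  measurable A -> measurable (cons_pair @^-1` A).
Proof. by rewrite -[X in _ -> measurable X]setTI; exact: measurable_cons_pair. Qed.

Let cons_measure0 : cons_measure mu set0 = 0.
Proof. by rewrite /cons_measure /pushforward preimage_set0 measure0. Qed.

Let cons_measure_ge0 A : 0 <= cons_measure mu A.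
Proof. exact: measure_ge0. Qed.

Let cons_measure_sigma_additive : semi_sigma_additive (cons_measure mu).
Proof.
move=> F mF tF mUF; rewrite /cons_measure /pushforward preimage_bigcup.
apply: measure_semi_sigma_additive.
- by move=> k; exact: measurable_preimage_cons.
- apply/trivIsetP => /= i j _ _ ij; rewrite -preimage_setI.
  by move/trivIsetP : tF => /(_ _ _ _ _ ij) ->//; rewrite preimage_set0.
- by rewrite -preimage_bigcup; exact: measurable_preimage_cons.
Qed.

HB.instance Definition _ := isMeasure.Build _ _ _ (cons_measure mu)
  cons_measure0 cons_measure_ge0 cons_measure_sigma_additive.

Let cons_measure_sigma_finite : sigma_finite setT (cons_measure mu).
Proof.
have /sigma_finiteP[F [TF ndF Foo]] := sigma_finiteT (@lebesgue_measure R).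
have /sigma_finiteP[G [TG ndG Goo]] := sigma_finiteT mu.
exists (fun k => uncons @^-1` (F k `*` G k)).
  rewrite -preimage_bigcup (_ : \bigcup_i _ = setT) ?preimage_setT//.
  apply/seteqP; split=> // -[x y] _.
  have [k _ Fkx] : (\bigcup_k F k) x by rewrite -TF.
  have [l _ Gly] : (\bigcup_k G k) y by rewrite -TG.
  exists (maxn k l) => //; split.
  - by move: x Fkx; exact/subsetPset/ndF/leq_maxl.
  - by move: y Gly; exact/subsetPset/ndG/leq_maxr.
move=> k; have [mF Fk] := Foo k; have [mG Gk] := Goo k; split.
  rewrite -[X in measurable X]setTI.
  by apply: measurable_uncons => //; exact: measurableX.
rewrite /cons_measure /pushforward -comp_preimage.
have -> : uncons \o cons_pair = id by apply/funext => p; exact: cons_pairK.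
by rewrite preimage_id product_measure1E// lte_mul_pinfty// ge0_fin_numE.
Qed.

HB.instance Definition _ := Measure_isSigmaFinite.Build _ _ _
  (cons_measure mu) cons_measure_sigma_finite.

End cons_measure.

(* n-dimensional Lebesgue measure on the Borel sets of R^n, as the iterated
   product of the one-dimensional measure. *)
Fixpoint lebesgue_tuple (R : realType) (n : nat) :
    {sigma_finite_measure set (n.-tuple (measurableTypeR R)) -> \bar R} :=
  match n with
  | 0 => \d_([tuple] : 0.-tuple (measurableTypeR R))
  | m.+1 => cons_measure (lebesgue_tuple R m)
  end.

Lemma lebesgue_tuple_box (R : realType) n
    (A : 'I_n -> set (measurableTypeR R)) :
  (forall i, measurable (A i)) ->
  lebesgue_tuple R n [set t | forall i, A i (tnth t i)] =
  (\prod_(i < n) lebesgue_measure (A i))%E.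
Proof.
elim: n A => [|n IH] A mA.
  by rewrite big_ord0 /= diracE mem_set// => -[].
rewrite big_ord_recl -IH//= /cons_measure /pushforward.
rewrite -product_measure1E//; last first.
  rewrite (_ : mkset _ = \bigcap_(i in [set: 'I_n])
      (fun t : n.-tuple (measurableTypeR R) => tnth t i) @^-1`
         A (lift ord0 i)).
    apply: fin_bigcap_measurable => // i _; rewrite -[X in measurable X]setTI.
    exact: (measurable_tnth i).
  by apply/seteqP; split=> t /= h i; [move=> _|]; exact: h.
congr (_ _); apply/seteqP; split=> -[x t] /=.
  move=> h; split=> [|i]; first by have := h ord0; rewrite tnth0.
  by have := h (lift ord0 i); rewrite tnthS.
move=> [h0 h] i; case: (unliftP ord0 i) => [j|] ->.
  by rewrite tnthS.
by rewrite tnth0.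
Qed.

(* The coordinates x_1, ..., x_n are tnth x 0, ..., tnth x n.-1, so
   that j = k+1, ..., l becomes k <= j < l. *)
Definition power_set (R : realType) (sigma rho : R) (n : nat) :
    set (n.-tuple (measurableTypeR R)) :=
  [set x | forall k l : nat, (k < l)%N -> (l <= n)%N ->
     \sum_(j < n | (k <= j < l)%N) tnth x j ^+ 2 <= sigma + (l - k)%:R * rho].

(* Taken in \bar R: lne 0 = -oo, so the limit lives in [-oo, +oo[. *)
Definition volume_exponent (R : realType) (sigma rho : R) : \bar R :=
  limn (fun n : nat =>
    (n%:R^-1)%:E * lne (lebesgue_tuple R n (power_set sigma rho (n:=n))))%E.

Section awgn.
Context {R : realType} d (Omega : measurableType d) (P : probability Omega R).

Definition mutually_independent (Z : nat -> {RV P >-> measurableTypeR R}) :=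
  forall (J : {fset nat}) (A : nat -> set (measurableTypeR R)),
    (forall i, measurable (A i)) ->
    P (\bigcap_(i in [set` J]) (Z i @^-1` A i)) =
    (\prod_(i <- J) P (Z i @^-1` A i))%E.

(* normal_prob is parametrized by the standard deviation, not the variance. *)
Definition awgn_noise (nu : R) (Z : nat -> {RV P >-> measurableTypeR R}) :=
  mutually_independent Z /\
  forall i (A : set (measurableTypeR R)), measurable A ->
    distribution P (Z i) A = normal_prob 0 (Num.sqrt nu) A.

Definition channel_output (Z : nat -> {RV P >-> measurableTypeR R}) n
    (x : n.-tuple (measurableTypeR R)) (omega : Omega) :
    n.-tuple (measurableTypeR R) :=
  [tuple tnth x i + Z i omega | i < n].

(* M is the number of messages. The decoding regions have to be Borel sets for
   the probability of error to make sense. *)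
Record code (sigma rho : R) (n M : nat) := Code {
  encode : 'I_M -> n.-tuple (measurableTypeR R) ;
  encode_power : forall m, power_set sigma rho (encode m) ;
  decode : n.-tuple (measurableTypeR R) -> 'I_M ;
  decode_measurable : forall m, measurable (decode @^-1` [set m]) }.

(* The message is uniform and independent of the noise. *)
Definition error_prob (Z : nat -> {RV P >-> measurableTypeR R})
    (sigma rho : R) n M (c : code sigma rho n M) : \bar R :=
  ((M%:R^-1)%:E * \sum_(m < M)
    P [set omega | decode c (channel_output Z (encode c m) omega) <> m])%E.

Definition num_messages (n : nat) (r : R) : nat := Num.truncn (expR (n%:R * r)).

Definition achievable (Z : nat -> {RV P >-> measurableTypeR R})
    (sigma rho r : R) :=
  exists c : forall n, code sigma rho n (num_messages n r),
    error_prob Z (c n) @[n --> \oo] --> 0%E.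

Definition capacity (Z : nat -> {RV P >-> measurableTypeR R})
    (sigma rho : R) : \bar R :=
  ereal_sup [set r%:E | r in [set r | achievable Z sigma rho r]].

End awgn.

(* Main.v *)
(** Achievability.  For [0 < al < 1] and small [ep], the centred Gaussian density
    [G] of variance [nu] on R^n satisfies a Young-type inequality
      iint u(x)^(1 - al ep) w(x + z)^ep G(z) dz dx
        <= e^(n ep c) (int u)^(1 - al ep) (int w)^ep,
    whose constant [c = young_const] becomes, as [ep] tends to 0 and for the
    optimal [al], the one of the entropy power inequality.  In dimension one
    it follows from AM-GM and a change of variables along the monotone map that
    transports [u] to a standard Gaussian, and it tensorizes.  Applied to the
    indicators of S_n and of a union [A] of at most e^(nr) balls of radius about
    sqrt(n nu), with [r] below the claimed rate, it gives a point [x] of S_n for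
    which [x + Z] falls in [A] with exponentially small probability.  Codewords
    can thus be chosen greedily, and one decodes to the first ball that
    contains the output.  Submultiplicativity of Vol(S_n) gives
    Vol(S_n) >= e^(n v) for every [n].

    Converse.  Let p_x be the output density for the input [x] and [q] the
    centred Gaussian density of variance [rho + nu].  Pointwise,
      p_x <= e^(n(C + eps)) q + p_x (p_x / (e^(n(C + eps)) q))^eps.
    The last term has an exponentially small integral by the power constraint,
    and the integrals of [q] over the decoding regions add up to 1. *)

From HB Require Import structures.
Require Import Defs.
From mathcomp Require Import all_boot all_order all_algebra finmap.
From mathcomp Require Import all_classical all_reals all_analysis.
From mathcomp Require Import measurable_realfun.
From mathcomp Require Import ring lra.
Set Implicit Arguments.
Unset Strict Implicit.
Unset Printing Implicit Defensive.
Import Order.TTheory GRing.Theory Num.Theory.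
Import numFieldNormedType.Exports.
Local Open Scope classical_set_scope.
Local Open Scope ring_scope.

(** * Integration on tuples *)

Section tuple_integral.
Context {R : realType}.
Local Open Scope ereal_scope.
Local Notation T := (measurableTypeR R).
Local Notation lam := (lebesgue_tuple R).

(** The Young inequality takes the place of an argument through mutual information. If X has density
    [u] and [w] is the density of X + Z, its derivative at [ep = 0] reads h(X + Z) >= al h(X) + (1 -
    al) h(Z) + H(al)/2, the linear form of the entropy power inequality, with H the binary entropy
    in nats. Entropies are averages, however, and say nothing about one codeword and a small set of
    outputs. Keeping [ep] positive costs a rate of order [ep] and in return bounds indicators of
    sets with an exponent linear in n, which is what a codebook needs. The two powers add up to more
    than 1; the excess (1 - al) ep is absorbed by the Jacobian of the change of variables, which
    AM-GM bounds below by a power of the slope of the transport map. Densities are only measurable,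
    so this slope is never a pointwise derivative: it enters through integrals over half-open
    intervals. In the converse, [rho + nu] is the variance of the optimal output; with it the terms
    of first order in [eps] cancel under the power constraint, up to a constant that depends on
    [sigma]. *)

Lemma measurable_cons_pair n :
  measurable_fun [set: T * n.-tuple T] (@cons_pair R n).
Proof. exact: measurable_cons. Qed.

Lemma integral_lebesgue_tuple0 (f : 0.-tuple T -> \bar R) :
  measurable_fun setT f ->
  \int[lam 0]_t f t = f [tuple].
Proof.
by move=> mf; rewrite /= integral_dirac// diracE mem_set// mul1e.
Qed.

Lemma integral_lebesgue_tupleS n (f : n.+1.-tuple T -> \bar R) :
  measurable_fun setT f -> (forall t, 0 <= f t) ->
  \int[lam n.+1]_t f t =
  \int[lebesgue_measure]_x \int[lam n]_t f (cons_pair (x, t)).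
Proof.
move=> mf f0; rewrite /= /cons_measure.
rewrite ge0_integral_pushforward//=; last exact: measurable_cons_pair.
rewrite preimage_setT fubini_tonelli1//.
exact: (measurableT_comp mf (@measurable_cons_pair n)).
Qed.

End tuple_integral.

(** * Measures given by a density *)

Section density_measure.
Local Open Scope ereal_scope.
Context d (X : measurableType d) {R : realType}.
Variables (mu : {measure set X -> \bar R}) (f : X -> R).
Hypotheses (mf : measurable_fun [set: X] f) (f0 : forall x, (0 <= f x)%R).

(** The proofs about [f] are arguments, so that the measure structure declared below can be inferred
    from the term alone. *)
Definition density_measure (_ : measurable_fun [set: X] f)
  (_ : forall x, (0 <= f x)%R) (A : set X) := \int[mu]_(x in A) (f x)%:E.

Local Notation nu := (density_measure mf f0).

Let mEf : measurable_fun [set: X] (EFin \o f).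
Proof. exact/measurable_EFinP. Qed.

Let nu0 : nu set0 = 0. Proof. exact: integral_set0. Qed.

Let nu_ge0 A : 0 <= nu A.
Proof. by apply: integral_ge0 => x _; rewrite lee_fin. Qed.

Let nu_sigma_additive : semi_sigma_additive nu.
Proof.
move=> F mF tF mUF; rewrite /density_measure ge0_integral_bigcup//.
- by apply: is_cvg_ereal_nneg_natsum_cond => n _ _; exact: nu_ge0.
- exact: measurable_funTS.
- by move=> x _; rewrite lee_fin.
Qed.

HB.instance Definition _ := isMeasure.Build _ _ _ nu nu0 nu_ge0
  nu_sigma_additive.

Import HBNNSimple.

Lemma integral_density_measure (g : X -> \bar R) :
  measurable_fun [set: X] g -> (forall x, 0 <= g x) ->
  \int[nu]_x g x = \int[mu]_x (g x * (f x)%:E).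
Proof.
move=> mg g0; pose h := nnsfun_approx measurableT mg.
have -> : \int[nu]_x g x = lim (\int[nu]_x (EFin \o h n) x @[n --> \oo]).
  have gE x : g x = lim ((EFin \o h n) x @[n --> \oo]).
    by apply/esym/cvg_lim => //; exact: cvg_nnsfun_approx.
  under eq_integral => x _ do rewrite gE.
  apply: monotone_convergence => //.
  - by move=> n; exact/measurable_EFinP.
  - by move=> n x _; rewrite lee_fin.
  - by move=> x _ a b ab; rewrite lee_fin; exact/lefP/nd_nnsfun_approx.
have -> : \int[mu]_x (g x * (f x)%:E) =
    lim (\int[mu]_x ((EFin \o h n) \* (EFin \o f)) x @[n --> \oo]).
  have gE x : g x * (f x)%:E = lim (((EFin \o h n) \* (EFin \o f)) x @[n --> \oo]).
    apply/esym/cvg_lim => //; apply: cvgeZr => //.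
    exact: cvg_nnsfun_approx.
  under eq_integral => x _ do rewrite gE.
  apply: monotone_convergence => //.
  - by move=> n; apply: emeasurable_funM => //; exact/measurable_EFinP.
  - by move=> n x _; rewrite mule_ge0// lee_fin.
  - move=> x _ a b ab /=; rewrite lee_wpmul2r ?lee_fin//.
    exact/lefP/nd_nnsfun_approx.
suff suf n : \int[mu]_x ((EFin \o h n) x * (f x)%:E) = \int[nu]_x (EFin \o h n) x.
  by under [in RHS]eq_fun do rewrite suf.
apply/esym.
transitivity (\int[nu]_x
   (\sum_(y \in range (h n)) (y * \1_(h n @^-1` [set y]) x)%:E)).
  by apply: eq_integral => t tE; rewrite /= fimfunE -fsumEFin.
rewrite ge0_integral_fsum//; last 2 first.
  - by move=> r; apply/measurable_EFinP; exact: measurable_funM.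
  - by move=> m y _; exact: nnfun_muleindic_ge0.
transitivity (\int[mu]_x (\sum_(y \in range (h n))
   ((y * \1_(h n @^-1` [set y]) x)%:E * (f x)%:E))); last first.
  apply: eq_integral => t tE; rewrite /= [in RHS]fimfunE -fsumEFin//.
  rewrite ge0_mule_fsuml// => y; exact: nnfun_muleindic_ge0.
rewrite ge0_integral_fsum//; last 2 first.
  - move=> r; apply: emeasurable_funM => //.
    by apply/measurable_EFinP; exact: measurable_funM.
  - by move=> m y _; rewrite mule_ge0 ?lee_fin ?f0//; exact: nnfun_muleindic_ge0.
apply: eq_fsbigr => r rhn.
under [RHS]eq_integral do rewrite EFinM -muleA.
rewrite integralZl_indic_nnsfun// integral_indic// setIT.
rewrite ge0_integralZl//.
- congr (_ * _); rewrite /density_measure [LHS]integral_mkcond.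
  apply: eq_integral => x _; rewrite /patch indicE/=.
  by case: ifPn => _; rewrite ?mul1e ?mul0e.
- by apply: emeasurable_funM => //; exact/measurable_EFinP.
- by move=> x _; rewrite mule_ge0// lee_fin.
- rewrite lee_fin; move: rhn; rewrite inE => -[x _ <-]; exact: fun_ge0.
Qed.

End density_measure.

Section product_integral.
Context {R : realType}.
Local Open Scope ereal_scope.
Local Notation T := (measurableTypeR R).
Local Notation lam := (lebesgue_tuple R).

Lemma prod_cons n (F : 'I_n.+1 -> T -> R) x (t : n.-tuple T) :
  (\prod_(i < n.+1) F i (tnth (cons_pair (x, t)) i) =
   F ord0 x * \prod_(i < n) F (lift ord0 i) (tnth t i))%R.
Proof.
by rewrite big_ord_recl tnth0; congr (_ * _)%R; apply: eq_bigr => i _; rewrite tnthS.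
Qed.

Lemma measurable_prod_tnth n (F : 'I_n -> T -> R) :
  (forall i, measurable_fun setT (F i)) ->
  measurable_fun setT (fun t : n.-tuple T => \prod_(i < n) F i (tnth t i))%R.
Proof.
move=> mF; apply: measurable_prod => i _.
by apply: measurableT_comp => //; exact: measurable_tnth.
Qed.

Lemma integral_prod_tnth n (F : 'I_n -> T -> R) :
  (forall i, measurable_fun setT (F i)) -> (forall i x, (0 <= F i x)%R) ->
  \int[lam n]_t (\prod_(i < n) F i (tnth t i))%:E =
  \prod_(i < n) \int[lebesgue_measure]_x (F i x)%:E.
Proof.
elim: n F => [F mF F0|n IH F mF F0].
  rewrite integral_lebesgue_tuple0 ?big_ord0//.
  by apply/measurable_EFinP; exact: measurable_prod_tnth.
rewrite integral_lebesgue_tupleS; last 2 first.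
  - by apply/measurable_EFinP; exact: measurable_prod_tnth.
  - by move=> t; rewrite lee_fin; apply: prodr_ge0 => i _.
under eq_integral => x _.
  under eq_integral do rewrite prod_cons EFinM.
  rewrite ge0_integralZl//; last 3 first.
  - apply/measurable_EFinP.
    by apply: (@measurable_prod_tnth _ (fun i => F (lift ord0 i))) => i.
  - by move=> t _; rewrite lee_fin; apply: prodr_ge0 => i _.
  - by rewrite lee_fin.
  rewrite (IH (fun i => F (lift ord0 i)))//; over.
rewrite ge0_integralZr//; last 3 first.
- exact/measurable_EFinP.
- by move=> x _; rewrite lee_fin.
- by apply: prode_ge0 => i _; apply: integral_ge0 => x _; rewrite lee_fin; exact: F0.
by rewrite big_ord_recl.
Qed.

End product_integral.

(** * The joint law of the noise *)

Section noise_law.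
Context {R : realType}.
Local Open Scope ereal_scope.
Local Notation T := (measurableTypeR R).
Local Notation lam := (lebesgue_tuple R).

Definition gauss_tuple (q : R) n (z : n.-tuple T) : R :=
  \prod_(i < n) normal_pdf 0 q (tnth z i).

Lemma gauss_tuple_ge0 q n (z : n.-tuple T) : (0 <= gauss_tuple q z)%R.
Proof. by apply: prodr_ge0 => i _; exact: normal_pdf_ge0. Qed.

Lemma measurable_gauss_tuple q n :
  measurable_fun setT (@gauss_tuple q n).
Proof.
apply: (@measurable_prod_tnth _ _ (fun=> normal_pdf 0 q)) => i.
exact: measurable_normal_pdf.
Qed.

Lemma gauss_tuple_cons q n x (t : n.-tuple T) :
  gauss_tuple q (cons_pair (x, t)) = (normal_pdf 0 q x * gauss_tuple q t)%R.
Proof. exact: (prod_cons (fun=> normal_pdf 0 q)). Qed.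

Lemma integral_gauss_tuple q n : \int[lam n]_z (gauss_tuple q z)%:E = 1.
Proof.
rewrite (integral_prod_tnth (F := fun=> normal_pdf 0 q)) => [|i|i x]; last 2 first.
- exact: measurable_normal_pdf.
- exact: normal_pdf_ge0.
by rewrite big1// => i _; rewrite integral_normal_pdf.
Qed.

Definition tuple_box n (A : 'I_n -> set T) : set (n.-tuple T) :=
  [set t | forall i, A i (tnth t i)].

Lemma measurable_tuple_box n (A : 'I_n -> set T) :
  (forall i, measurable (A i)) -> measurable (tuple_box A).
Proof.
move=> mA; rewrite (_ : tuple_box A =
    \bigcap_(i in [set: 'I_n]) (fun t : n.-tuple T => tnth t i) @^-1` A i).
  apply: fin_bigcap_measurable => // i _; rewrite -[X in measurable X]setTI.
  exact: (measurable_tnth i).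
by apply/seteqP; split=> t /= h i; [move=> _|]; exact: h.
Qed.

(** Boxes are closed under intersection and generate the sigma-algebra, since a cylinder over one
    coordinate is a box with all other sides [setT]. Finite mass lets the constant sequence [setT]
    be the exhausting cover. *)
Lemma measure_tuple_unique n (m1 m2 : {measure set (n.-tuple T) -> \bar R}) :
  (forall A : 'I_n -> set T, (forall i, measurable (A i)) ->
    m1 (tuple_box A) = m2 (tuple_box A)) ->
  m1 setT < +oo ->
  forall A, measurable A -> m1 A = m2 A.
Proof.
move=> m12 m1oo A mA.
pose boxes : set (set (n.-tuple T)) :=
  [set B | exists2 A, (forall i, measurable (A i)) & B = tuple_box A].
have boxT : boxes setT.
  by exists (fun=> setT) => //; apply/seteqP; split.
apply: (@measure_unique _ _ _ boxes (fun=> setT)) => //.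
- apply/seteqP; split.
    move=> B; apply: smallest_sub; first exact: smallest_sigma_algebra.
    move=> C; rewrite -bigcup_seq/= => -[i _] [D mD <-].
    apply: sub_sigma_algebra; exists (fun j => if j == i then D else setT).
      by move=> j; case: ifP.
    rewrite setTI; apply/seteqP; split => t /=.
      by move=> Dt j; case: eqP => // ->.
    by move=> /(_ i); rewrite eqxx.
  apply: smallest_sub; first exact: sigma_algebra_measurable.
  by move=> _ [B mB ->]; exact: measurable_tuple_box.
- move=> _ _ [B mB ->] [C mC ->]; exists (fun i => B i `&` C i).
    by move=> i; exact: measurableI.
  by apply/seteqP; split => t /=; [case=> h1 h2 i; split|move=> h; split=> i; have [] := h i].
- by apply/seteqP; split => // t _; exists 0%N.
- by move=> _ [B mB ->]; exact: m12.
Qed.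

Context d (Omega : measurableType d) (P : probability Omega R).
Variables (nu : R) (Z : nat -> {RV P >-> T}).
Hypothesis noiseZ : awgn_noise nu Z.

Definition noise_tuple n (omega : Omega) : n.-tuple T := [tuple Z i omega | i < n].

Lemma measurable_noise_tuple n : measurable_fun setT (@noise_tuple n).
Proof.
apply/measurable_fun_tnthP => i; rewrite (_ : _ \o _ = Z i)//.
by apply/funext => w /=; rewrite tnth_mktuple.
Qed.

Lemma noise_tupleE n A : measurable A ->
  P (@noise_tuple n @^-1` A) = \int[lam n]_(z in A) (gauss_tuple (Num.sqrt nu) z)%:E.
Proof.
have [indZ normZ] := noiseZ; move=> mA.
have mN := @measurable_noise_tuple n.
pose m1 : {measure set (n.-tuple T) -> \bar R} :=
  density_measure (lam n) (measurable_gauss_tuple (Num.sqrt nu) (n:=n)) (gauss_tuple_ge0 _ (n:=n)).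
pose N : {RV P >-> n.-tuple T} := HB.pack (@noise_tuple n) (isMeasurableFun.Build _ _ _ _ _ mN).
pose m2 : {measure set (n.-tuple T) -> \bar R} := distribution P N.
apply/esym; apply: (@measure_tuple_unique n m1 m2) => //; last first.
  by rewrite [X in X < _](integral_gauss_tuple (Num.sqrt nu) n) ltry.
move=> B mB.
(* Independence concerns families indexed by [nat], so the sides of the box are continued by [setT]
   from index n on. *)
pose A' i := if insub i is Some j then B j else setT.
have mA' i : measurable (A' i) by rewrite /A'; case: insub.
have A'E (i : 'I_n) : A' i = B i by rewrite /A' valK.
have [J permJ] : exists J : {fset nat}, perm_eq J (iota 0 n).
  exists (seq_fset tt (iota 0 n)).
  by apply: (perm_trans (seq_fset_perm _ _)); rewrite undup_id// iota_uniq.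
have memJ i : (i \in J) = (i < n)%N by rewrite (perm_mem permJ) mem_iota.
transitivity (\prod_(i < n) P (Z i @^-1` B i)); last first.
  have := indZ J A' mA'.
  rewrite (perm_big _ permJ)/= -[in X in _ = X]val_enum_ord.
  rewrite big_map -big_enum/=.
  under [X in _ = X -> _]eq_bigr do rewrite A'E.
  rewrite big_enum/= => <-; rewrite /m2 /distribution /pushforward; congr (P _).
  apply/seteqP; split => w /=.
    by move=> h i; rewrite tnth_mktuple -A'E; apply: h; rewrite /= memJ.
  move=> h i /=; rewrite memJ => ilt.
  have := h (Ordinal ilt).
  by rewrite tnth_mktuple -A'E.
rewrite /m1 /= /density_measure integral_mkcond.
transitivity (\int[lam n]_z (\prod_(i < n)
    (\1_(B i) (tnth z i) * normal_pdf 0 (Num.sqrt nu) (tnth z i)))%:E).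
  apply: eq_integral => z _; rewrite big_split/= /patch; case: ifPn.
    by rewrite inE => Bz; rewrite big1 ?mul1r// => i _; rewrite indicE mem_set//.
  move=> /negP; rewrite inE => Bz.
  have [i Bi] : exists i, ~ B i (tnth z i) by apply/existsNP.
  by rewrite (bigD1 i)//= indicE memNset// !mul0r.
rewrite (@integral_prod_tnth _ n (fun i x => \1_(B i) x * normal_pdf 0 (Num.sqrt nu) x)%R).
- apply: eq_bigr => i _.
  have -> : P (Z i @^-1` B i) = normal_prob 0 (Num.sqrt nu) (B i) by exact: normZ.
  rewrite /normal_prob [RHS]integral_mkcond.
  apply: eq_integral => x _; rewrite /patch indicE.
  by case: ifPn; rewrite ?mul1r ?mul0r.
- by move=> i; apply: measurable_funM => //; exact: measurable_normal_pdf.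
- by move=> i x; rewrite mulr_ge0// normal_pdf_ge0.
Qed.

End noise_law.

(** * Gaussian integrals *)

Section gaussian_integral.
Context {R : realType}.
Implicit Types a b q x : R.

Lemma normal_pdf_expR m q x : 0 < q ->
  normal_pdf m q x = expR (- (ln (2 * pi * q ^+ 2) / 2) - (x - m) ^+ 2 / (2 * q ^+ 2)).
Proof.
move=> q0; rewrite normal_pdfE ?gt_eqF// expRD; congr (_ * _).
  rewrite /normal_peak expRN; congr (_^-1).
  have h : 0 < 2 * pi * q ^+ 2 :> R by rewrite !mulr_gt0 ?pi_gt0 ?exprn_gt0.
  rewrite -powR12_sqrt; last by rewrite mulrn_wge0// mulr_ge0 ?sqr_ge0// pi_ge0.
  have -> : q ^+ 2 * pi *+ 2 = 2 * pi * q ^+ 2 :> R by rewrite -mulr_natl; ring.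
  by rewrite /powR gt_eqF// mulrC.
by rewrite /normal_fun mulNr -[q ^+ 2 *+ 2]mulr_natl.
Qed.

(** Completing the square gives a multiple of the normal density of mean [b / a] and variance
    [a^-1]. *)
Lemma integral_expR_quadratic a b : 0 < a ->
  (\int[lebesgue_measure]_x (expR (- (a / 2 * x ^+ 2) + b * x))%:E =
   (expR (ln (2 * pi / a) / 2 + b ^+ 2 / (2 * a)))%:E)%E.
Proof.
move=> a0; set K := expR (ln _ / 2 + _).
pose q := Num.sqrt a^-1.
have q0 : 0 < q by rewrite sqrtr_gt0 invr_gt0.
have q2 : q ^+ 2 = a^-1 by rewrite sqr_sqrtr// invr_ge0 ltW.
transitivity (\int[lebesgue_measure]_x (K%:E * (normal_pdf (b / a) q x)%:E))%E.
  apply: eq_integral => x _; rewrite -EFinM; congr EFin.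
  rewrite normal_pdf_expR// /K -expRD q2; congr expR.
  rewrite -/(2 * pi / a); field; lra.
rewrite ge0_integralZl//.
- by rewrite integral_normal_pdf mule1.
- by apply/measurable_EFinP; exact: measurable_normal_pdf.
- by move=> x _; rewrite lee_fin normal_pdf_ge0.
- by rewrite lee_fin expR_ge0.
Qed.

(** This is ln y <= y - 1 at y = 1 / (1 + a). *)
Lemma ln_1D_ge a : -1 < a -> a / (1 + a) <= ln (1 + a).
Proof.
move=> a1; have h : 0 < 1 + a by lra.
have := @le_ln1Dx R ((1 + a)^-1 - 1).
rewrite addrCA subrr addr0 lnV ?posrE// => H.
have : 0 < (1 + a)^-1 by rewrite invr_gt0.
move=> h2; have {H} := H ltac:(lra).
have -> : (1 + a)^-1 - 1 = - (a / (1 + a)) by field; lra.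
by rewrite lerN2.
Qed.

End gaussian_integral.

(** * Monotone transport *)

Section change_of_variable.
Context {R : realType}.
Local Notation mu := (@lebesgue_measure R).
Local Notation T := (measurableTypeR R).
Implicit Types D w : R -> R.

Local Open Scope ereal_scope.

Lemma measurable_incr w : {homo w : x y / (x < y)%R} ->
  measurable_fun [set: T] (w : T -> T).
Proof.
move=> wi; apply: nondecreasing_measurable => // x y.
by rewrite le_eqVlt => /predU1P[->//|xy]; exact/ltW/wi.
Qed.

(** [D1] plays the role of D2(w) w', but only masses of half-open intervals are compared: the image
    of D1 dx under [w] and the measure D2 dx agree on a generating pi-system. This form suits a
    transport map known only through distribution functions. *)
Lemma ge0_integral_increasing_substitution (w D1 D2 : R -> R) (H : R -> \bar R) :
  measurable_fun [set: T] D1 -> (forall x, 0 <= D1 x)%R ->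
  measurable_fun [set: T] D2 -> (forall x, 0 <= D2 x)%R ->
  {homo w : x y / (x < y)%R} -> (forall y, exists x, w x = y) ->
  (forall x y, (x < y)%R -> \int[mu]_(t in `]x, y]) (D1 t)%:E =
    \int[mu]_(t in `]w x, w y]) (D2 t)%:E) ->
  (forall x y, \int[mu]_(t in `]x, y]) (D1 t)%:E < +oo) ->
  measurable_fun [set: T] H -> (forall x, 0 <= H x) ->
  \int[mu]_x (H (w x) * (D1 x)%:E) = \int[mu]_x (H x * (D2 x)%:E).
Proof.
move=> mD1 D10 mD2 D20 w_incr w_surj D12 D1oo mH H0.
have mw := measurable_incr w_incr.
have w_mono : {mono w : x y / (x <= y)%R} by exact: le_mono.
rewrite -(integral_density_measure mu mD2 D20)//.
rewrite -(integral_density_measure mu mD1 D10 (g := H \o w)); last 2 first.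
- exact: measurableT_comp.
- by move=> x; exact: H0.
set m1 := density_measure mu mD1 _; set m2 := density_measure mu mD2 _.
rewrite -[LHS](ge0_integral_pushforward mw m1 (D := setT))//.
apply: eq_measure_integral => A mA _.
have preim x y : w @^-1` `]w x, w y] = `]x, y]%classic.
  by apply/seteqP; split => t /=; rewrite !in_itv/= w_mono !ltNge w_mono.
apply: (@measure_unique _ R T (@ocitv R) (fun k => `](- k%:R)%R, k%:R]%classic)) => //.
- exact: ocitvI.
- by move=> i; exact: is_ocitv.
- apply/seteqP; split => // x _; exists (Num.truncn `|x|).+1 => //=.
  have xb := truncnS_gt `|x|.
  rewrite in_itv/=; move: xb; rewrite ltr_norml => /andP[-> xb].
  exact: ltW.
- move=> _ [[a b] _ <-] /=; rewrite /pushforward.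
  (* Surjectivity writes any interval as ]w x, w y], whose preimage is ]x, y]. *)
  have [x wx] := w_surj a; have [y wy] := w_surj b.
  rewrite -wx -wy preim /m1 /m2 /density_measure.
  have [xy|yx] := ltP x y; first exact: D12.
  rewrite set_itv_ge ?bnd_simp -?leNgt// set_itv_ge ?bnd_simp -?leNgt ?w_mono//.
  by rewrite !integral_set0.
- move=> k; have [x wx] := w_surj (- k%:R)%R; have [y wy] := w_surj k%:R.
  by rewrite /= /pushforward -wx -wy preim; exact: D1oo.
Qed.

Lemma ge0_integral_affine (a b : R) (H : R -> \bar R) : (0 < a)%R ->
  measurable_fun [set: T] H -> (forall x, 0 <= H x) ->
  \int[mu]_x H (a * x + b)%R = a^-1%:E * \int[mu]_x H x.
Proof.
move=> a0 mH H0.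
transitivity (a^-1%:E * \int[mu]_x (H x * (1%R)%:E)); last first.
  by congr (_ * _); under eq_integral do rewrite mule1.
rewrite -(@ge0_integral_increasing_substitution (fun x => a * x + b)%R
  (fun=> a) (fun=> 1%R) H)//.
- rewrite ge0_integralZr//.
  + by rewrite muleC -muleA -EFinM mulfV ?gt_eqF// mule1.
  + apply: measurableT_comp => //; apply: measurable_incr => x y xy.
    by rewrite ltrD2r ltr_pM2l.
  + by rewrite lee_fin ltW.
- by move=> x; exact: ltW.
- by move=> x y xy; rewrite ltrD2r ltr_pM2l.
- by move=> y; exists ((y - b) / a)%R; rewrite mulrCA mulfV ?gt_eqF// mulr1 subrK.
- move=> x y xy; rewrite !integral_cst//= !lebesgue_measure_itv/=.
  rewrite !lte_fin xy ltrD2r ltr_pM2l// xy -!EFinD -!EFinM; congr EFin; ring.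
- move=> x y; rewrite integral_cst//= lebesgue_measure_itv/=.
  by case: ifP => _; rewrite ?mule0// -EFinD -EFinM ltry.
Qed.

End change_of_variable.

(** * Positive densities and their transport *)

Section positive_density.
Context {R : realType}.
Local Notation mu := (@lebesgue_measure R).
Local Notation T := (measurableTypeR R).
Implicit Types f : R -> R.
Local Open Scope ereal_scope.

Definition positive_density f := [/\ measurable_fun [set: T] f,
  forall x, (0 < f x)%R & \int[mu]_x (f x)%:E = 1].

Definition density_cdf f (x : R) : R := fine (\int[mu]_(t in `]-oo, x]) (f t)%:E).

Section facts.
Variable f : R -> R.
Hypothesis df : positive_density f.

Let mf : measurable_fun [set: T] f. Proof. by case: df. Qed.
Let f_gt0 x : (0 < f x)%R. Proof. by case: df. Qed.
Let f_ge0 x : 0 <= (f x)%:E. Proof. by rewrite lee_fin ltW. Qed.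
Let mEf : measurable_fun [set: T] (EFin \o f). Proof. exact/measurable_EFinP. Qed.

Let int_le1 A : measurable A -> \int[mu]_(t in A) (f t)%:E <= 1.
Proof.
move=> mA; case: df => _ _ <-.
by apply: ge0_subset_integral => // x _; rewrite lee_fin ltW.
Qed.

Let int_fin A : measurable A -> \int[mu]_(t in A) (f t)%:E \is a fin_num.
Proof.
move=> mA; rewrite ge0_fin_numE ?integral_ge0//.
by rewrite (le_lt_trans (int_le1 mA))// ltry.
Qed.

Lemma positive_density_integrable : mu.-integrable setT (EFin \o f).
Proof.
apply/integrableP; split => //.
under eq_integral do rewrite (gee0_abs (f_ge0 _)).
by case: df => _ _ ->; rewrite ltry.
Qed.

Lemma density_cdfE x : (density_cdf f x)%:E = \int[mu]_(t in `]-oo, x]) (f t)%:E.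
Proof. by rewrite fineK// int_fin. Qed.

Lemma integral_density_itv x y : (x < y)%R ->
  \int[mu]_(t in `]x, y]) (f t)%:E = (density_cdf f y - density_cdf f x)%:E.
Proof.
move=> xy; rewrite EFinB !density_cdfE.
have -> : `]-oo, y]%classic = `]-oo, x] `|` `]x, y].
  apply/seteqP; split => t /=; rewrite !in_itv/=.
    by move=> ty; case: (leP t x) => tx; [left|right].
  by move=> [tx|/andP[]//]; rewrite (le_trans tx)// ltW.
rewrite ge0_integral_setU//; last 2 first.
- exact: measurable_funTS.
- apply/disj_set2P/seteqP; split => t //=; rewrite !in_itv/= => -[tx /andP[xt _]].
  by move: xt; rewrite ltNge tx.
by rewrite addeAC subee ?add0e// int_fin.
Qed.

Lemma integral_density_gt0 (A : set T) : measurable A -> 0 < mu A ->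
  0 < \int[mu]_(t in A) (f t)%:E.
Proof.
move=> mA A0; rewrite lt_neqAle integral_ge0// andbT eq_sym; apply/eqP => fA.
have mAf : measurable_fun A (EFin \o f) by exact: measurable_funTS.
have : \int[mu]_(t in A) `|(EFin \o f) t| = 0.
  by under eq_integral do rewrite (gee0_abs (f_ge0 _)).
move/(ae_eq_integral_abs mu mA mAf) => [N [mN N0 AN]].
suff AN' : A `<=` N.
  have : mu A <= mu N by apply: le_measure; rewrite ?inE.
  by rewrite N0 leNgt A0.
move=> x Ax; apply: AN => /= /(_ Ax) [fx].
by have := f_gt0 x; rewrite fx ltxx.
Qed.

Lemma density_cdf_incr : {homo density_cdf f : x y / (x < y)%R}.
Proof.
move=> x y xy; rewrite -subr_gt0 -lte_fin -integral_density_itv//.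
apply: integral_density_gt0 => //.
by rewrite /= lebesgue_measure_itv/= lte_fin xy -EFinB lte_fin subr_gt0.
Qed.

Lemma density_cdf_gt0 x : (0 < density_cdf f x)%R.
Proof.
rewrite -lte_fin density_cdfE; apply: integral_density_gt0 => //.
by rewrite /= lebesgue_measure_itv/= ltNyr ltry.
Qed.

Lemma density_cdf_lt1 x : (density_cdf f x < 1)%R.
Proof.
have xx1 : (x < x + 1)%R by rewrite ltrDl.
rewrite (lt_le_trans (density_cdf_incr xx1))//.
by rewrite -lee_fin density_cdfE; exact: int_le1.
Qed.

Lemma density_cdf_continuous a b : (a <= b)%R ->
  {within `[a, b], continuous (density_cdf f)}.
Proof.
move=> ab.
have intf : mu.-integrable `[a, b] (EFin \o f).
  exact: integrableS positive_density_integrable.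
have ctn := parameterized_integral_continuous ab intf.
have E x : x \in `[a, b] ->
    (density_cdf f a + parameterized_integral mu a x f)%R = density_cdf f x.
  rewrite in_itv/= => /andP[ax xb].
  rewrite /parameterized_integral /Rintegral -integral_itv_obnd_cbnd; last first.
    exact: measurable_funTS.
  move: ax; rewrite le_eqVlt => /predU1P[->|ax].
    by rewrite set_itv_ge ?bnd_simp// integral_set0 addr0.
  by rewrite integral_density_itv//= addrC subrK.
apply: (subspace_eq_continuous (f := fun x => density_cdf f a + parameterized_integral mu a x f)%R).
  by move=> x; rewrite inE => /E.
by move=> x; apply: cvgD; [exact: cvg_cst|exact: ctn].
Qed.

Lemma density_cdf_cvgy : density_cdf f n%:R @[n --> \oo] --> (1%R : R).
Proof.
apply: (@fine_cvg _ _ _ _ (fun n => \int[mu]_(t in `]-oo, n%:R]) (f t)%:E)).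
have -> : (1%R)%:E = \int[mu]_(t in \bigcup_n `]-oo, n%:R]%classic) (f t)%:E.
  case: df => _ _ <-; congr (integral _ _ _); apply/esym/seteqP; split=> // x _.
  exists (Num.truncn `|x|).+1 => //=; rewrite in_itv/= ltW//.
  by rewrite (le_lt_trans (ler_norm x))// truncnS_gt.
apply: ge0_nondecreasing_set_cvg_integral => //.
- move=> m n mn; apply/subsetPset => x /=; rewrite !in_itv/= => /le_trans; apply.
  by rewrite ler_nat.
- by move=> n; exact: measurable_funTS.
Qed.

Lemma density_cdf_cvgNy : density_cdf f (- n%:R) @[n --> \oo] --> (0%R : R).
Proof.
(* The complements ]x, +oo[ increase to the line as x decreases, so the limit at -oo also follows
   from convergence along increasing sets. *)
have E x : density_cdf f x = (1 - fine (\int[mu]_(t in `]x, +oo[) (f t)%:E))%R.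
  apply: EFin_inj; rewrite EFinB density_cdfE fineK ?int_fin//.
  case: df => _ _ <-.
  have -> : [set: T] = `]-oo, x] `|` `]x, +oo[.
    by apply/seteqP; split => t //= _; rewrite !in_itv/= andbT; case: (leP t x) => tx; [left|right].
  rewrite ge0_integral_setU//.
  - by rewrite addeK// int_fin.
  - exact: measurable_funTS.
  apply/disj_set2P/seteqP; split => t //=; rewrite !in_itv/= andbT => -[tx].
  by rewrite ltNge tx.
under eq_fun do rewrite E.
have <- : (1 - 1 = 0 :> R)%R by rewrite subrr.
apply: cvgB; first exact: cvg_cst.
apply: (@fine_cvg _ _ _ _ (fun n => \int[mu]_(t in `](- n%:R)%R, +oo[) (f t)%:E)).
have -> : (1%R)%:E = \int[mu]_(t in \bigcup_n `](- n%:R)%R, +oo[%classic) (f t)%:E.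
  case: df => _ _ <-; congr (integral _ _ _); apply/esym/seteqP; split=> // x _.
  exists (Num.truncn `|x|).+1 => //=; rewrite in_itv/= andbT ltrNl.
  by rewrite (le_lt_trans (ler_norm (- x)%R))// normrN truncnS_gt.
apply: ge0_nondecreasing_set_cvg_integral => //.
- move=> m n mn; apply/subsetPset => x /=; rewrite !in_itv/= !andbT; apply: le_lt_trans.
  by rewrite lerN2 ler_nat.
- by move=> n; exact: measurable_funTS.
Qed.

Lemma density_cdf_surj p : (0 < p < 1)%R -> exists x, density_cdf f x = p.
Proof.
move=> /andP[p0 p1].
have [m Hm] : exists m : nat, (density_cdf f (- m%:R) < p)%R.
  have /cvgrPdist_lt/(_ p p0)[m _ /(_ m (leqnn _))] := density_cdf_cvgNy.
  rewrite sub0r normrN => /= H; exists m; exact: le_lt_trans (ler_norm _) H.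
have [n Hn] : exists n : nat, (p < density_cdf f n%:R)%R.
  have p1' : (0 < 1 - p)%R by rewrite subr_gt0.
  have /cvgrPdist_lt/(_ _ p1')[n _ /(_ n (leqnn _))] := density_cdf_cvgy.
  move=> /= H; exists n; have := le_lt_trans (ler_norm _) H.
  by rewrite ltrD2l ltrN2.
have mn : (- m%:R <= n%:R :> R)%R by rewrite (@le_trans _ _ 0%R)// oppr_le0.
have := @IVT _ (density_cdf f) _ _ p mn (density_cdf_continuous mn).
rewrite (min_idPl _) ?(max_idPr _) ?(ltW Hm) ?(ltW Hn)//=.
- by move=> /(_ isT)[c _ <-]; exists c.
- exact/ltW/(lt_trans Hm).
- exact/ltW/(lt_trans Hm).
Qed.

End facts.

(** [tau] is the distribution function of [f] followed by the inverse of that of [g]. Positivity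
    makes both increasing bijections onto ]0, 1[, hence [tau] an increasing bijection of the
    line. *)
Lemma transport_exists f g : positive_density f -> positive_density g ->
  exists tau : R -> R, [/\ {homo tau : x y / (x < y)%R},
    (forall y, exists x, tau x = y) &
    forall x, density_cdf g (tau x) = density_cdf f x].
Proof.
move=> df dg.
have E x : exists t, density_cdf g t = density_cdf f x.
  by apply: density_cdf_surj; rewrite // density_cdf_gt0// density_cdf_lt1.
pose tau x := sval (cid (E x)).
have tauE x : density_cdf g (tau x) = density_cdf f x by rewrite /tau; case: cid.
have cdf_mono h : positive_density h -> {mono density_cdf h : x y / (x < y)%R}.
  by move=> dh; apply/leW_mono/le_mono/density_cdf_incr.
exists tau; split => //.
- by move=> x y xy; rewrite -(cdf_mono _ dg) !tauE (cdf_mono _ df).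
- move=> y; have [x fx] : exists x, density_cdf f x = density_cdf g y.
    by apply: density_cdf_surj; rewrite // density_cdf_gt0// density_cdf_lt1.
  exists x; have : density_cdf g (tau x) = density_cdf g y by rewrite tauE.
  by apply: inc_inj; exact/le_mono/density_cdf_incr.
Qed.

Section transport.
Variables f g tau : R -> R.
Hypotheses (df : positive_density f) (dg : positive_density g).
Hypothesis tau_incr : {homo tau : x y / (x < y)%R}.
Hypothesis tau_surj : forall y, exists x, tau x = y.
Hypothesis tauE : forall x, density_cdf g (tau x) = density_cdf f x.

Lemma integral_transport (H : T -> \bar R) :
  measurable_fun [set: T] H -> (forall x, 0 <= H x) ->
  \int[mu]_x (H (tau x) * (f x)%:E) = \int[mu]_x (H x * (g x)%:E).
Proof.
move=> mH H0; have [mf f0 _] := df; have [mg g0 _] := dg.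
apply: ge0_integral_increasing_substitution => //.
- by move=> x; exact/ltW.
- by move=> x; exact/ltW.
- by move=> x y xy; rewrite !integral_density_itv ?tauE//; exact: tau_incr.
- move=> x y; have [xy|yx] := ltP x y.
    by rewrite integral_density_itv// ltry.
  by rewrite set_itv_ge ?bnd_simp -?leNgt// integral_set0.
Qed.

(** The integrated form of tau' = f / (g o tau), obtained by transporting the indicator of ]tau x,
    tau y] divided by [g]. *)
Lemma integral_transport_slope x y : (x < y)%R ->
  \int[mu]_(t in `]x, y]) (f t / g (tau t))%:E = (tau y - tau x)%:E.
Proof.
move=> xy; have [mf f0 _] := df; have [mg g0 _] := dg.
have mono : {mono tau : x y / (x <= y)%R} by exact: le_mono.
transitivity (\int[mu]_t (((\1_`]tau x, tau y] (tau t) / g (tau t))%:E) * (f t)%:E)).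
  rewrite integral_mkcond; apply: eq_integral => t _; rewrite /patch indicE.
  have -> : (tau t \in `]tau x, tau y]%classic) = (t \in `]x, y]%classic).
    by apply/idP/idP; rewrite !inE/= !in_itv/= mono !ltNge mono.
  by case: ifP => _; rewrite ?mul0r ?mul0e// mul1r -EFinM mulrC.
rewrite (integral_transport (H := fun t => (\1_`]tau x, tau y] t / g t)%:E)); last 2 first.
- apply/measurable_EFinP; apply: measurable_funM => //.
  under eq_fun do rewrite -[g _]lnK ?posrE// -expRN.
  do 2 (apply: measurableT_comp => //).
  exact: measurableT_comp.
- by move=> t; rewrite lee_fin mulr_ge0// invr_ge0 ltW.
under eq_integral do rewrite -EFinM divfK ?gt_eqF//.
by rewrite integral_indic// setIT/= lebesgue_measure_itv/= lte_fin tau_incr// -EFinB.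
Qed.

End transport.

End positive_density.

(** * A Young inequality for the Gaussian kernel *)

Section young1.
Context {R : realType}.
Local Notation mu := (@lebesgue_measure R).
Local Notation T := (measurableTypeR R).

(** The graph lies above its tangent at the barycentre [m]; averaging this bound at [x] and [y]
    cancels the linear terms. *)
Lemma expR_convex (a x y : R) : 0 <= a <= 1 ->
  expR (a * x + (1 - a) * y) <= a * expR x + (1 - a) * expR y.
Proof.
move=> /andP[a0 a1]; set m := a * x + (1 - a) * y.
have H t : expR m * (1 + (t - m)) <= expR t.
  have -> : expR t = expR m * expR (t - m) by rewrite -expRD addrC subrK.
  by rewrite ler_pM2l ?expR_gt0// expR_ge1Dx.
have h1 : a * (expR m * (1 + (x - m))) <= a * expR x by rewrite ler_wpM2l.
have h2 : (1 - a) * (expR m * (1 + (y - m))) <= (1 - a) * expR y.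
  by rewrite ler_wpM2l// subr_ge0.
apply: le_trans (lerD h1 h2); rewrite le_eqVlt; apply/orP; left; apply/eqP.
by rewrite /m; ring.
Qed.

Lemma measurable_expR_quadratic (a b : R) :
  measurable_fun [set: T] (fun x : R => expR (- (a * x ^+ 2) + b * x)).
Proof.
apply: measurableT_comp => //; apply: measurable_funD; last exact: measurable_funM.
by apply: measurableT_comp => //; apply: measurable_funM => //; exact: measurable_funX.
Qed.

Lemma gauss_positive_density : positive_density (normal_pdf (0:R) 1).
Proof.
split; first exact: measurable_normal_pdf.
- by move=> x; rewrite normal_pdf_expR// expR_gt0.
- exact: integral_normal_pdf.
Qed.

Lemma iter_integral_lin (F G : T * T -> R) (a b : R) :
  measurable_fun [set: T * T] F -> measurable_fun [set: T * T] G ->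
  (forall p, 0 <= F p) -> (forall p, 0 <= G p) -> 0 <= a -> 0 <= b ->
  (\int[mu]_x \int[mu]_y (a * F (x, y) + b * G (x, y))%:E =
   a%:E * \int[mu]_x \int[mu]_y (F (x, y))%:E +
   b%:E * \int[mu]_x \int[mu]_y (G (x, y))%:E)%E.
Proof.
move=> mF mG F0 G0 a0 b0.
have mx (H : T * T -> R) x : measurable_fun [set: T * T] H ->
    measurable_fun [set: T] (fun y => (H (x, y))%:E).
  by move=> mH; apply/measurable_EFinP; exact: (measurableT_comp mH).
have mI (H : T * T -> R) : measurable_fun [set: T * T] H -> (forall p, 0 <= H p) ->
    measurable_fun [set: T] (fun x => \int[mu]_y (H (x, y))%:E)%E.
  move=> mH H0; apply: (measurable_fun_fubini_tonelli_F (EFin \o H) (m2 := mu)).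
    exact/measurable_EFinP.
  by move=> p; rewrite lee_fin.
have I0 (H : T * T -> R) x : (forall p, 0 <= H p) -> (0 <= \int[mu]_y (H (x, y))%:E)%E.
  by move=> H0; apply: integral_ge0 => y _; rewrite lee_fin.
transitivity (\int[mu]_x (a%:E * \int[mu]_y (F (x, y))%:E + b%:E * \int[mu]_y (G (x, y))%:E))%E.
  apply: eq_integral => x _; under eq_integral do rewrite EFinD !EFinM.
  rewrite ge0_integralD//=.
  - by rewrite !ge0_integralZl//; [exact: mx|move=> y _; rewrite lee_fin|exact: mx|move=> y _; rewrite lee_fin].
  - by move=> y _; rewrite -EFinM lee_fin mulr_ge0.
  - by apply: emeasurable_funM => //; exact: mx.
  - by move=> y _; rewrite -EFinM lee_fin mulr_ge0.
  - by apply: emeasurable_funM => //; exact: mx.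
rewrite ge0_integralD//=.
- by rewrite !ge0_integralZl//; [exact: mI|move=> y _; exact: I0|exact: mI|move=> y _; exact: I0].
- by move=> y _; rewrite mule_ge0 ?lee_fin// I0.
- by apply: emeasurable_funM => //; exact: mI.
- by move=> y _; rewrite mule_ge0 ?lee_fin// I0.
- by apply: emeasurable_funM => //; exact: mI.
Qed.

Section core.
Variables (al ep q : R).
Hypotheses (al0 : 0 < al) (al1 : al < 1) (ep0 : 0 < ep) (ep2 : ep <= 1/2)
  (q0 : 0 < q).

Let c := Num.sqrt al.
Let s := Num.sqrt (1 - al).
(** When y = c z / q - s tau(x) is held fixed, the derivative of x + z in x is 1 + th tau'(x). *)
Let th := q * s / c.

Let c0 : 0 < c. Proof. by rewrite sqrtr_gt0. Qed.
Let s0 : 0 < s. Proof. by rewrite sqrtr_gt0 subr_gt0. Qed.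
Let c2 : c ^+ 2 = al. Proof. by rewrite sqr_sqrtr// ltW. Qed.
Let s2 : s ^+ 2 = 1 - al. Proof. by rewrite sqr_sqrtr// subr_ge0 ltW. Qed.
Let th0 : 0 < th. Proof. by rewrite divr_gt0// mulr_gt0. Qed.

Let ln_c : ln c = ln al / 2.
Proof. by rewrite -[in RHS]c2 lnXn//; field. Qed.
Let ln_s : ln s = ln (1 - al) / 2.
Proof. by rewrite -[in RHS]s2 lnXn//; field. Qed.
Let ln_th : ln th = ln q + ln (1 - al) / 2 - ln al / 2.
Proof. by rewrite /th ln_div ?posrE// ?mulr_gt0// lnM ?posrE// ln_c ln_s. Qed.

(** The minimum over t > 0 of ln(1 + th t) - (1 - al) ln t, attained at t = (1 - al) / (al th). This
    is the slope for a Gaussian [f] of variance q^2 al / (1 - al), the one whose share in the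
    variance of the sum is [al]. *)
Definition young_slope := (1 - al) * ln th - al * ln al - (1 - al) * ln (1 - al).

(* AM-GM with weights al and 1 - al. *)
Lemma young_slope_le t : 0 < t -> expR (young_slope + (1 - al) * ln t) <= 1 + th * t.
Proof.
move=> t0; have al1' : 0 < 1 - al by rewrite subr_gt0.
have tht : 0 < th * t by exact: mulr_gt0.
have := @expR_convex al (- ln al) (ln (th * t / (1 - al))).
have -> : al * - ln al + (1 - al) * ln (th * t / (1 - al)) = young_slope + (1 - al) * ln t.
  by rewrite ln_div ?posrE// lnM ?posrE// /young_slope; ring.
move=> H; apply: le_trans (H _) _; first by rewrite !ltW.
rewrite expRN !lnK ?posrE// ?divr_gt0//.
by rewrite mulfV ?gt_eqF// mulrCA mulfV ?gt_eqF// mulr1.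
Qed.

(* One coordinate of the rotation of (z / q, g) by the angle with cosine c and
   sine s. *)
Definition young_lin (g z : R) := c * z / q - s * g.

(** The factor that remains when exp(- lin^2 / 2)^ep is split off: with phi the standard normal
    density and N that of variance q^2, phi(g)^((1 - al) ep) N(z) = exp(- lin^2 / 2)^ep
    young_weight^(1 - ep), where lin = [young_lin g z]. *)
Definition young_weight (g z : R) : R :=
  expR (((1 - al) * ep * (- (ln (2 * pi) / 2) - g ^+ 2 / 2)
    + (- (ln (2 * pi * q ^+ 2) / 2) - z ^+ 2 / (2 * q ^+ 2))
    + ep * young_lin g z ^+ 2 / 2) / (1 - ep)).

(** The determinant of the quadratic form in (g, z / q) that stands in the exponent of
    [young_weight g z] times the standard normal density of g. *)
Definition young_det := ((1 - ep) * (1 - ep * al) - ep ^+ 2 * al * (1 - al)) / (1 - ep) ^+ 2.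

Let det_num_gt0 : 0 < (1 - ep) * (1 - ep * al) - ep ^+ 2 * al * (1 - al).
Proof.
have [? ? ? ?] := And4 al0 al1 ep0 ep2.
have b1 : 0 <= 1 - al by lra.
have b2 : 0 <= ep * (1 - al) by rewrite mulr_ge0// ltW.
have a1 : 1 / 2 <= 1 - ep * al by lra.
have a2 : (1 / 2) * (1 / 2) <= (1 - ep) * (1 - ep * al) by rewrite ler_pM//; lra.
have a3 : ep ^+ 2 <= (1 / 2) ^+ 2 by rewrite lerXn2r ?nnegrE// ltW.
have a4 : 0 <= al * (1 - al) by rewrite mulr_ge0// ltW.
have a4' : al * (1 - al) <= 1 / 4.
  by have := sqr_ge0 (al - 1 / 2); lra.
have a5 : ep ^+ 2 * (al * (1 - al)) <= 1 / 4 * (1 / 4).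
  by rewrite ler_pM ?sqr_ge0//; lra.
lra.
Qed.

Lemma young_det_gt0 : 0 < young_det.
Proof.
have [? ? ? ?] := And4 al0 al1 ep0 ep2.
by apply: divr_gt0 => //; apply: exprn_gt0; lra.
Qed.

(** The expansion to first order in [ep] with an explicit error, from ln(1 + a) >= a / (1 + a). The
    correction 1 - 2 ep reappears as the term [2 * ep] of [young_const]. *)
Lemma ln_young_det : ep * (1 - al) * (1 - 2 * ep) <= (1 - ep) * ln young_det.
Proof.
have [? ? ? ?] := And4 al0 al1 ep0 ep2.
have d0 := young_det_gt0.
have ep1 : 0 < 1 - ep by lra.
have -> : young_det = 1 + (young_det - 1) by ring.
have := @ln_1D_ge R (young_det - 1); rewrite [1 + _]addrC subrK => H.
have {}H := H ltac:(lra).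
apply: (@le_trans _ _ ((1 - ep) * ((young_det - 1) / young_det))); last first.
  by rewrite ler_pM2l.
have -> : (1 - ep) * ((young_det - 1) / young_det) =
    (1 - ep) * (ep * (1 - al) * (1 - ep - ep * al)) / ((1 - ep) * (1 - ep * al) - ep ^+ 2 * al * (1 - al)).
  rewrite /young_det; field; rewrite ?gt_eqF//=; lra.
rewrite ler_pdivlMr//.
have A : 0 <= ep * (1 - al) by rewrite mulr_ge0// ?ltW// subr_gt0.
have -> : (1 - ep) * (ep * (1 - al) * (1 - ep - ep * al)) =
  ep * (1 - al) * ((1 - ep) * (1 - ep - ep * al)) by ring.
rewrite -[leLHS]mulrA; apply: ler_wpM2l => //.
have B : 0 <= ep ^+ 2 * (al * (1 - al)) by rewrite mulr_ge0 ?sqr_ge0// mulr_ge0//; lra.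
have C : 0 <= (1 - 2 * ep) * (ep ^+ 2 * (al * (1 - al))) by rewrite mulr_ge0//; lra.
have D : 0 <= (1 - ep) * (ep * (1 - 2 * (ep * al))).
  rewrite mulr_ge0//; first lra.
  rewrite mulr_ge0//; first lra.
  have : ep * al <= 1 / 2 * 1 by rewrite ler_pM//; lra.
  lra.
rewrite -subr_ge0.
have -> : (1 - ep) * (1 - ep - ep * al) - (1 - 2 * ep) * ((1 - ep) * (1 - ep * al) - ep ^+ 2 * al * (1 - al)) =
  (1 - ep) * (ep * (1 - 2 * (ep * al))) + (1 - 2 * ep) * (ep ^+ 2 * (al * (1 - al))) by ring.
exact: addr_ge0.
Qed.

Let ln_2piq : ln (2 * pi * q ^+ 2) = ln (2 * pi) + 2 * ln q.
Proof.
rewrite lnM ?posrE ?exprn_gt0// ?mulr_gt0 ?pi_gt0// lnXn//; ring.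
Qed.

Definition young_mass := - ((1 - al) * ep * ln (2 * pi) + ln (2 * pi * q ^+ 2)) / (2 * (1 - ep))
  + ln (2 * pi * q ^+ 2) / 2 - ln young_det / 2.

(** Elimination of z: [za] is its precision in [young_weight g z], [ga] the precision of g against
    the standard normal density once z is integrated out, and [k0] the constant in the exponent. *)
Let za := (1 - ep * al) / ((1 - ep) * q ^+ 2).
Let ga := 1 - ep ^+ 2 * al * (1 - al) / ((1 - ep) * (1 - ep * al)).
Let k0 := - ((1 - al) * ep * ln (2 * pi) + ln (2 * pi * q ^+ 2)) / (2 * (1 - ep)).

Let epal : 0 < 1 - ep * al.
Proof.
have [? ? ? ?] := And4 al0 al1 ep0 ep2.
have : ep * al <= 1 / 2 * 1 by rewrite ler_pM//; lra.
lra.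
Qed.

Let ep1 : 0 < 1 - ep. Proof. have := ep2; lra. Qed.

Let za_gt0 : 0 < za.
Proof. by rewrite divr_gt0// mulr_gt0// exprn_gt0. Qed.

Let ga_gt0 : 0 < ga.
Proof.
by rewrite /ga subr_gt0 ltr_pdivrMr ?mul1r; [rewrite -subr_gt0|exact: mulr_gt0].
Qed.

Let za_ga : ln za + ln ga = ln young_det - 2 * ln q.
Proof.
rewrite -lnM ?posrE//.
have -> : za * ga = young_det / q ^+ 2.
  rewrite /za /ga /young_det; field.
  by rewrite ?gt_eqF.
rewrite ln_div ?posrE ?young_det_gt0 ?exprn_gt0// lnXn//; ring.
Qed.

Lemma young_weightE g z : young_weight g z =
  expR k0 * expR (- (za / 2 * z ^+ 2) + (- ep * c * s * g / (q * (1 - ep))) * z).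
Proof.
rewrite /young_weight -expRD; congr expR.
have -> : young_lin g z ^+ 2 = c ^+ 2 * z ^+ 2 / q ^+ 2 - 2 * c * s * z * g / q + s ^+ 2 * g ^+ 2.
  by rewrite /young_lin; field; rewrite gt_eqF.
rewrite c2 s2 /k0 /za; field.
by rewrite ?gt_eqF.
Qed.

Lemma measurable_young_weight g : measurable_fun [set: T] (young_weight g).
Proof.
rewrite (_ : young_weight g = fun z => expR k0 *
  expR (- (za / 2 * z ^+ 2) + (- ep * c * s * g / (q * (1 - ep))) * z)).
  by apply: measurable_funM => //; exact: measurable_expR_quadratic.
by apply/funext => z; exact: young_weightE.
Qed.

Lemma integral_young_weight g : (\int[mu]_z (young_weight g z)%:E =
  (expR (k0 + ln (2 * pi / za) / 2 + (1 - ga) / 2 * g ^+ 2))%:E)%E.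
Proof.
under eq_integral do rewrite young_weightE EFinM.
rewrite ge0_integralZl//; last by apply/measurable_EFinP; exact: measurable_expR_quadratic.
rewrite integral_expR_quadratic// -EFinM -expRD; congr (expR _)%:E.
have -> : (- ep * c * s * g / (q * (1 - ep))) ^+ 2 =
  ep ^+ 2 * c ^+ 2 * s ^+ 2 * g ^+ 2 / (q ^+ 2 * (1 - ep) ^+ 2) by field; rewrite ?gt_eqF.
rewrite c2 s2 -addrA; congr (_ + (_ + _)).
rewrite /za /ga; field.
by rewrite ?gt_eqF.
Qed.

Lemma integral_young_weight_gauss : (\int[mu]_g
  (expR (k0 + ln (2 * pi / za) / 2 + (1 - ga) / 2 * g ^+ 2) * normal_pdf 0 1 g)%:E =
  (expR young_mass)%:E)%E.
Proof.
transitivity (\int[mu]_g ((expR (k0 + ln (2 * pi / za) / 2 - ln (2 * pi) / 2))%:E *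
    (expR (- (ga / 2 * g ^+ 2) + 0 * g))%:E))%E.
  apply: eq_integral => g _; rewrite -EFinM normal_pdf_expR// -!expRD; congr (expR _)%:E.
  by rewrite expr1n mulr1 subr0; field.
rewrite ge0_integralZl//; last by apply/measurable_EFinP; exact: measurable_expR_quadratic.
rewrite integral_expR_quadratic// -EFinM -expRD; congr (expR _)%:E.
have pi2 : 0 < 2 * pi :> R by rewrite mulr_gt0// pi_gt0.
have lnK2 (x : R) : 0 < x -> ln (2 * pi / x) = ln (2 * pi) - ln x.
  by move=> xp; rewrite ln_div ?posrE.
rewrite expr0n/= mul0r addr0 (lnK2 _ za_gt0) (lnK2 _ ga_gt0) /young_mass -/k0 ln_2piq.
have := za_ga; lra.
Qed.

(** * The inequality for a positive density *)

Section bound.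
Variables f w tau : R -> R.
Hypotheses (df : positive_density f) (mw : measurable_fun [set: T] w)
  (w0 : forall x, 0 <= w x).
Hypothesis tau_incr : {homo tau : x y / x < y}.
Hypothesis tau_surj : forall y, exists x, tau x = y.
Hypothesis tauE : forall x, density_cdf (normal_pdf 0 1) (tau x) = density_cdf f x.

Let g := normal_pdf (0:R) 1.
Let dg : positive_density g := gauss_positive_density.
Let mf : measurable_fun [set: T] f. Proof. by case: df. Qed.
Let f0 x : 0 < f x. Proof. by case: df. Qed.
Let mg : measurable_fun [set: T] g. Proof. by case: dg. Qed.
Let g0 x : 0 < g x. Proof. by case: dg. Qed.
Let mtau : measurable_fun [set: T] (tau : T -> R). Proof. exact: measurable_incr. Qed.

Definition young_jac x := 1 + th * (f x / g (tau x)).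

Let slope x := f x / g (tau x).

Let slope_gt0 x : 0 < slope x. Proof. exact: divr_gt0. Qed.

Let mslope : measurable_fun [set: T] slope.
Proof.
apply: measurable_funM => //.
under eq_fun do rewrite -[g _]lnK ?posrE// -expRN.
do 2 apply: measurableT_comp => //.
by do 2 apply: measurableT_comp => //.
Qed.

Lemma young_jac_gt0 x : 0 < young_jac x.
Proof. by rewrite ltr_wpDr// mulr_ge0// ltW// slope_gt0. Qed.

Lemma measurable_young_jac : measurable_fun [set: T] young_jac.
Proof. by apply: measurable_funD => //; exact: measurable_funM. Qed.

(* The map x |-> x + (q / c)(y + s tau x) is increasing with derivative young_jac. *)
Lemma integral_young_jac y :
  (\int[mu]_x (w (x + q / c * (y + s * tau x)) * young_jac x)%:E = \int[mu]_x (w x)%:E)%E.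
Proof.
pose W x := x + q / c * (y + s * tau x).
have W_incr : {homo W : x y / x < y}.
  move=> x x' xx'; rewrite /W ltrD// ltr_pM2l ?divr_gt0// ltrD2l ltr_pM2l//.
  exact: tau_incr.
have qc : 0 < q / c by exact: divr_gt0.
transitivity (\int[mu]_x ((w (W x))%:E * (young_jac x)%:E))%E.
  by apply: eq_integral => x _; rewrite EFinM.
transitivity (\int[mu]_x ((w x)%:E * 1%:E))%E; last first.
  by apply: eq_integral => x _; rewrite mule1.
(* The integrated form of W' = [young_jac]. *)
have slopeI a b : a < b -> (\int[mu]_(x in `]a, b]) (young_jac x)%:E = (W b - W a)%:E)%E.
  move=> ab.
  under eq_integral do rewrite EFinD EFinM.
  rewrite ge0_integralD//; last 2 first.
  - by move=> x _; rewrite mule_ge0// lee_fin ltW// slope_gt0.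
  - apply: emeasurable_funM => //; apply/measurable_EFinP; apply: measurable_funTS.
    exact: mslope.
  rewrite ge0_integralZl//; last 3 first.
  - by apply/measurable_EFinP; apply: measurable_funTS; exact: mslope.
  - by move=> x _; rewrite lee_fin ltW// slope_gt0.
  - by rewrite lee_fin ltW.
  rewrite (integral_transport_slope df dg)// integral_cst//= lebesgue_measure_itv/=.
  rewrite lte_fin ab mul1e -EFinB -EFinM -EFinD; congr EFin.
  by rewrite /W /th; ring.
apply: (ge0_integral_increasing_substitution (H := EFin \o w)) => //.
- exact: measurable_young_jac.
- by move=> x; exact/ltW/young_jac_gt0.
(* If [tau] were frozen at its value in 0, [r] would solve W r = v. As [tau] is increasing, v lies
   between the values of [W] at the ends of the segment from 0 to [r], and the intermediate value
   theorem applies: an increasing surjection is continuous. *)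
- move=> v; pose r := v - q / c * (y + s * tau 0).
  pose a := Num.min 0 r; pose b := Num.max 0 r.
  have ab : a <= b by rewrite le_max ge_min lexx.
  have le_tau x x' : x <= x' -> tau x <= tau x'.
    by rewrite le_eqVlt => /predU1P[->//|]; move/tau_incr/ltW.
  have Wa : W a <= v.
    rewrite /W -lerBrDr (@le_trans _ _ r)// ?ge_min ?lexx ?orbT// lerD2l lerN2.
    by rewrite ler_pM2l// lerD2l ler_pM2l// le_tau// ge_min lexx.
  have Wb : v <= W b.
    rewrite /W -lerBlDr (@le_trans _ _ r)// ?le_max ?lexx ?orbT// lerD2l lerN2.
    by rewrite ler_pM2l// lerD2l ler_pM2l// le_tau// le_max lexx.
  have tau_mono : {mono tau : x y / x <= y} by exact: le_mono.
  have ctau : {within `[a, b], continuous tau}.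
    apply: segment_inc_surj_continuous.
      by move=> x x' _ _; exact: tau_mono.
    move=> u /=; rewrite in_itv/= => /andP[au ub].
    have [x xu] := tau_surj u; exists x => //=.
    by rewrite in_itv/= -tau_mono xu au -tau_mono xu.
  have cW : {within `[a, b], continuous W}.
    move=> x; apply: cvgD; first exact: (continuous_subspaceT (fun=> cvg_id)).
    apply: cvgM; first exact: cvg_cst.
    apply: cvgD; first exact: cvg_cst.
    by apply: cvgM; [exact: cvg_cst|exact: ctau].
  have [|x _ <-] := IVT ab cW (v := v); last by exists x.
  by rewrite ge_min Wa/= le_max Wb orbT.
- move=> a b ab; rewrite slopeI// integral_cst//= lebesgue_measure_itv/= lte_fin.
  by rewrite W_incr// mul1e -EFinB.
- move=> a b; have [ab|ba] := ltP a b; first by rewrite slopeI// ltry.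
  by rewrite set_itv_ge ?bnd_simp -?leNgt// integral_set0.
- exact/measurable_EFinP.
Qed.

Let qc0 : 0 < q / c. Proof. exact: divr_gt0. Qed.

Let mjac2 : measurable_fun [set: T * T] (fun p : T * T => young_jac p.1).
Proof. by apply: (measurableT_comp measurable_young_jac). Qed.

Let mtau2 : measurable_fun [set: T * T] (fun p : T * T => tau p.1).
Proof. by apply: (measurableT_comp mtau). Qed.

(** At fixed x the variable z becomes y = [young_lin (tau x) z], with dz = (q / c) dy. After
    Tonelli, x + z as a function of x at fixed y has Jacobian exactly [young_jac], so the inner
    integral is that of [w] and only a Gaussian integral in y is left. *)
Lemma integral_young_push :
  (\int[mu]_x \int[mu]_z (w (x + z) * young_jac x * expR (- (young_lin (tau x) z ^+ 2 / 2)))%:E =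
   (expR (ln q - ln c + ln (2 * pi) / 2))%:E * \int[mu]_x (w x)%:E)%E.
Proof.
pose H x y := w (x + q / c * (y + s * tau x)) * young_jac x * expR (- (y ^+ 2 / 2)).
have H0 x y : 0 <= H x y by rewrite !mulr_ge0 ?expR_ge0// ltW// young_jac_gt0.
have mH : measurable_fun [set: T * T] (fun p : T * T => H p.1 p.2).
  apply: measurable_funM; first apply: measurable_funM => //.
    apply: (measurableT_comp mw); apply: measurable_funD => //.
    apply: measurable_funM => //; apply: measurable_funD => //.
    exact: measurable_funM.
  do 2 apply: measurableT_comp => //.
  by apply: measurable_funM => //; exact: measurable_funX.
transitivity (\int[mu]_x ((q / c)%:E * \int[mu]_y (H x y)%:E))%E.
  apply: eq_integral => x _.
  have -> : q / c = (c / q)^-1 by rewrite invf_div.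
  rewrite -(@ge0_integral_affine _ (c / q) (- (s * tau x)) (fun y => (H x y)%:E)); last 3 first.
  - exact: divr_gt0.
  - by apply/measurable_EFinP; exact: (measurableT_comp mH (pair1_measurable x)).
  - by move=> y; rewrite lee_fin.
  apply: eq_integral => z _; rewrite /H; congr ((w _ * _ * expR (- (_ ^+ 2 / 2)))%:E).
    by rewrite subrK; field; rewrite ?gt_eqF.
  by rewrite /young_lin mulrAC.
rewrite ge0_integralZl//; last 3 first.
- apply: (measurable_fun_fubini_tonelli_F (fun p : T * T => (H p.1 p.2)%:E) (m2 := mu)).
    exact/measurable_EFinP.
  by move=> p; rewrite lee_fin.
- by move=> x _; apply: integral_ge0 => y _; rewrite lee_fin.
- by rewrite lee_fin ltW.
rewrite (fubini_tonelli (m1 := mu) (m2 := mu) (fun p : T * T => (H p.1 p.2)%:E))//=; last 2 first.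
- exact/measurable_EFinP.
- by move=> p; rewrite lee_fin.
transitivity ((q / c)%:E * \int[mu]_y ((expR (- (y ^+ 2 / 2)))%:E * \int[mu]_x (w x)%:E))%E.
  congr (_ * _)%E; apply: eq_integral => y _.
  rewrite -(integral_young_jac y) -ge0_integralZl//.
  - by apply: eq_integral => x _; rewrite -EFinM /H mulrC.
  - apply/measurable_EFinP; apply: measurable_funM; last exact: measurable_young_jac.
    apply: (measurableT_comp mw); apply: measurable_funD => //.
    apply: measurable_funM => //; apply: measurable_funD => //.
    exact: measurable_funM.
  - by move=> x _; rewrite lee_fin mulr_ge0// ltW// young_jac_gt0.
rewrite ge0_integralZr//; last 2 first.
- apply/measurable_EFinP; do 2 apply: measurableT_comp => //.
  by apply: measurable_funM => //; exact: measurable_funX.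
- by apply: integral_ge0 => y _; rewrite lee_fin.
rewrite muleA; congr (_ * _)%E.
have -> : (\int[mu]_y (expR (- (y ^+ 2 / 2)))%:E = \int[mu]_y (expR (- (1 / 2 * y ^+ 2) + 0 * y))%:E)%E.
  by apply: eq_integral => y _; rewrite mul0r addr0 div1r mulrC.
rewrite integral_expR_quadratic// -EFinM; congr EFin.
rewrite -[q]lnK ?posrE// -[c]lnK ?posrE// !expRK -expRN -!expRD.
by rewrite divr1 expr0n mul0r addr0.
Qed.

(** Transport along [tau] replaces f(x) dx by the standard Gaussian measure, so the mass does not
    depend on [f]. *)
Lemma integral_young_mass :
  (\int[mu]_x \int[mu]_z (f x * young_weight (tau x) z)%:E = (expR young_mass)%:E)%E.
Proof.
rewrite -integral_young_weight_gauss.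
pose J g := (expR (k0 + ln (2 * pi / za) / 2 + (1 - ga) / 2 * g ^+ 2))%:E.
transitivity (\int[mu]_x (J (tau x) * (f x)%:E))%E.
  apply: eq_integral => x _; under eq_integral do rewrite EFinM.
  rewrite ge0_integralZl//; last 3 first.
  - apply/measurable_EFinP; exact: measurable_young_weight.
  - by move=> z _; rewrite lee_fin expR_ge0.
  - by rewrite lee_fin ltW.
  by rewrite integral_young_weight muleC.
rewrite (integral_transport df dg tau_incr tau_surj tauE)//=.
- by apply/measurable_EFinP; apply: measurableT_comp => //; apply: measurable_funD => //; apply: measurable_funM.
- by move=> x; rewrite lee_fin expR_ge0.
Qed.

Let push := ln q - ln c + ln (2 * pi) / 2.

(* Convexity of expR with weights ep and 1 - ep; both terms are normalized to have
   integral at most 1. *)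
Lemma young_pointwise x z W : 0 < W ->
  f x `^ (1 - al * ep) * w (x + z) `^ ep * normal_pdf 0 q z <=
  expR (- ep * young_slope + ep * (push + ln W) + (1 - ep) * young_mass) *
  (ep * (expR (- (push + ln W)) *
      (w (x + z) * young_jac x * expR (- (young_lin (tau x) z ^+ 2 / 2)))) +
   (1 - ep) * (expR (- young_mass) * (f x * young_weight (tau x) z))).
Proof.
move=> W0.
have RHS0 v : 0 <= v -> 0 <= expR (- ep * young_slope + ep * (push + ln W) + (1 - ep) * young_mass) *
  (ep * (expR (- (push + ln W)) *
      (v * young_jac x * expR (- (young_lin (tau x) z ^+ 2 / 2)))) +
   (1 - ep) * (expR (- young_mass) * (f x * young_weight (tau x) z))).
  move=> v0; rewrite mulr_ge0 ?expR_ge0// addr_ge0//.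
    by rewrite !mulr_ge0 ?expR_ge0// ltW// young_jac_gt0.
  by rewrite !mulr_ge0 ?expR_ge0// ltW.
(* Logarithms require w(x + z) > 0; where it vanishes, so does its power, as [ep] is nonzero. *)
have := w0 (x + z); rewrite le_eqVlt => /predU1P[<-|wpos].
  by rewrite powR0 ?gt_eqF// mulr0 mul0r RHS0.
set lin := young_lin _ _ in RHS0 *.
(* The exponent 1 - al ep exceeds the convexity weight 1 - ep by (1 - al) ep. This bound, multiplied
   by [ep], trades the excess power of [f] for [young_jac] and a power of g(tau x), which
   [young_weight] already contains. *)
have jac_ge : young_slope + (1 - al) * (ln (f x) - ln (g (tau x))) <= ln (young_jac x).
  rewrite -ln_div ?posrE// -[leLHS]expRK ler_ln ?posrE ?expR_gt0 ?young_jac_gt0//.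
  by apply: young_slope_le; exact: slope_gt0.
have lng : ln (g (tau x)) = - (ln (2 * pi) / 2) - tau x ^+ 2 / 2.
  by rewrite /g normal_pdf_expR// expRK expr1n !mulr1 subr0.
rewrite {RHS0} normal_pdf_expR// subr0 -[w (x + z)]lnK ?posrE// -[young_jac x]lnK ?posrE ?young_jac_gt0//.
rewrite -[f x]lnK ?posrE// -!expRM /young_weight -/lin -!expRD.
set E1 := - (push + ln W) + _; set E2 := - young_mass + _.
apply: (@le_trans _ _ (expR (- ep * young_slope + ep * (push + ln W) + (1 - ep) * young_mass)
  * expR (ep * E1 + (1 - ep) * E2))); last first.
  by rewrite ler_pM2l ?expR_gt0// expR_convex// ltW//=; have := ep2; lra.
rewrite -expRD ler_expR /E2.
rewrite [(1 - ep) * (- young_mass + _)]mulrDr [(1 - ep) * (ln (f x) + _)]mulrDr.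
rewrite [(1 - ep) * (_ / _)]mulrC divfK ?gt_eqF// /E1.
have := ler_wpM2l (ltW ep0) jac_ge; rewrite lng.
by rewrite /lin; set y2 := young_lin _ _ ^+ 2; lra.
Qed.

(** Equal to - (1 - al) h - H(al)/2 + (1 - al) ep, where h = ln(2 pi e q^2)/2 is the entropy of the
    noise and H the binary entropy. *)
Definition young_const := (al * ln al + (1 - al) * ln (1 - al)
  - (1 - al) * (ln (2 * pi * q ^+ 2) + 1 - 2 * ep)) / 2.

(** Apart from [ln_young_det] this is an identity. *)
Lemma young_exponent : - ep * young_slope + ep * push + (1 - ep) * young_mass <= ep * young_const.
Proof.
have D := ln_young_det.
rewrite /young_slope /young_mass /young_const /push ln_th ln_c ln_2piq.
have -> : (1 - ep) * (- ((1 - al) * ep * ln (2 * pi) + (ln (2 * pi) + 2 * ln q)) / (2 * (1 - ep)) +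
    (ln (2 * pi) + 2 * ln q) / 2 - ln young_det / 2) =
  - ((1 - al) * ep * ln (2 * pi) + (ln (2 * pi) + 2 * ln q)) / 2 +
    (1 - ep) * (ln (2 * pi) + 2 * ln q) / 2 - (1 - ep) * ln young_det / 2.
  by field; rewrite gt_eqF.
by lra.
Qed.

Lemma young_transported W : 0 < W -> (\int[mu]_x (w x)%:E <= W%:E)%E ->
  (\int[mu]_x \int[mu]_z (f x `^ (1 - al * ep) * w (x + z) `^ ep * normal_pdf 0 q z)%:E <=
   (expR (ep * young_const) * W `^ ep)%:E)%E.
Proof.
move=> W0 wW.
set M := - ep * young_slope + ep * (push + ln W) + (1 - ep) * young_mass.
pose A (p : T * T) := w (p.1 + p.2) * young_jac p.1 * expR (- (young_lin (tau p.1) p.2 ^+ 2 / 2)).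
pose B (p : T * T) := f p.1 * young_weight (tau p.1) p.2.
have A0 p : 0 <= A p by rewrite !mulr_ge0 ?expR_ge0// ltW// young_jac_gt0.
have B0 p : 0 <= B p by rewrite mulr_ge0 ?expR_ge0// ltW.
have mlin : measurable_fun [set: T * T] (fun p : T * T => young_lin (tau p.1) p.2).
  by apply: measurable_funB; apply: measurable_funM => //; exact: measurable_funM.
have mA : measurable_fun [set: T * T] A.
  apply: measurable_funM; first apply: measurable_funM => //.
    by apply: (measurableT_comp mw); exact: measurable_funD.
  do 2 apply: measurableT_comp => //.
  by apply: measurable_funM => //; exact: measurable_funX.
have mB : measurable_fun [set: T * T] B.
  apply: measurable_funM; first exact: (measurableT_comp mf).
  apply: measurableT_comp => //; apply: measurable_funM => //.
  apply: measurable_funD; last first.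
    by apply: measurable_funM => //; apply: measurable_funM => //; exact: measurable_funX.
  apply: measurable_funD.
    apply: measurable_funM => //; apply: measurable_funB => //.
    by apply: measurable_funM => //; exact: measurable_funX.
  apply: measurable_funB => //; apply: measurable_funM => //.
  exact: measurable_funX.
pose a := expR M * (ep * expR (- (push + ln W))).
pose b := expR M * ((1 - ep) * expR (- young_mass)).
apply: (@le_trans _ _ (\int[mu]_x \int[mu]_z (a * A (x, z) + b * B (x, z))%:E)%E).
  have mAB : measurable_fun [set: T * T] (fun p => a * A p + b * B p).
    by apply: measurable_funD; exact: measurable_funM.
  have AB0 p : 0 <= a * A p + b * B p.
    by rewrite addr_ge0// mulr_ge0// !mulr_ge0 ?expR_ge0// ltW.
  have mL : measurable_fun [set: T * T] (fun p : T * T =>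
      f p.1 `^ (1 - al * ep) * w (p.1 + p.2) `^ ep * normal_pdf 0 q p.2).
    apply: measurable_funM.
      apply: measurable_funM.
        by apply: (measurableT_comp (measurable_powR _)); exact: (measurableT_comp mf).
      apply: (measurableT_comp (measurable_powR _)); apply: (measurableT_comp mw).
      exact: measurable_funD.
    by apply: (measurableT_comp (measurable_normal_pdf _ _)).
  have L0 p : 0 <= f p.1 `^ (1 - al * ep) * w (p.1 + p.2) `^ ep * normal_pdf 0 q p.2.
    by rewrite !mulr_ge0 ?powR_ge0 ?normal_pdf_ge0.
  apply: ge0_le_integral => //.
  - by move=> x _; apply: integral_ge0 => z _; rewrite lee_fin (L0 (x, z)).
  - apply: (measurable_fun_fubini_tonelli_F (fun p : T * T => (f p.1 `^ (1 - al * ep) * w (p.1 + p.2) `^ ep * normal_pdf 0 q p.2)%:E) (m2 := mu)).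
      exact/measurable_EFinP.
    by move=> p; rewrite lee_fin.
  - apply: (measurable_fun_fubini_tonelli_F (fun p : T * T => (a * A p + b * B p)%:E) (m2 := mu)).
      exact/measurable_EFinP.
    by move=> p; rewrite lee_fin.
  - move=> x _; apply: ge0_le_integral => //.
    + by move=> z _; rewrite lee_fin (L0 (x, z)).
    + by apply/measurable_EFinP; exact: (measurableT_comp mL (pair1_measurable x)).
    + by apply/measurable_EFinP; exact: (measurableT_comp mAB (pair1_measurable x)).
    + move=> z _; rewrite lee_fin; apply: (le_trans (young_pointwise x z W0)).
      by rewrite -/M /a /b /A /B/= mulrDr !mulrA.
rewrite iter_integral_lin//; last 2 first.
- by rewrite !mulr_ge0 ?expR_ge0// ltW.
- by rewrite !mulr_ge0 ?expR_ge0// ltW.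
rewrite integral_young_push integral_young_mass.
apply: (@le_trans _ _ (expR M)%:E).
  apply: (@le_trans _ _ (a%:E * ((expR push)%:E * W%:E) + b%:E * (expR young_mass)%:E)%E).
    rewrite leeD2r//; apply: lee_wpmul2l.
      by rewrite lee_fin !mulr_ge0 ?expR_ge0// ltW.
    by apply: lee_wpmul2l => //; rewrite lee_fin expR_ge0.
  rewrite -!EFinM -EFinD lee_fin /a /b.
  rewrite -[X in expR push * X]lnK ?posrE// -expRD -!mulrA -!expRD.
  by rewrite !addNr expR0 !mulr1 -mulrDr subrKC mulr1.
rewrite lee_fin -[W in W `^ _]lnK ?posrE// -expRM -expRD ler_expR.
have := young_exponent; rewrite /M; lra.
Qed.

End bound.

End core.

End young1.

Section iterated.
Local Open Scope ereal_scope.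
Context d1 d2 (X : measurableType d1) (Y : measurableType d2) {R : realType}.
Variables (m1 : {sigma_finite_measure set X -> \bar R})
  (m2 : {sigma_finite_measure set Y -> \bar R}).
Variable F : X -> Y -> \bar R.
Hypotheses (mF : measurable_fun [set: X * Y] (fun p => F p.1 p.2))
  (F0 : forall x y, 0 <= F x y).

Lemma measurable_integral2 : measurable_fun [set: X] (fun x => \int[m2]_y F x y).
Proof. exact: (measurable_fun_fubini_tonelli_F (fun p => F p.1 p.2) (m2 := m2)). Qed.

Lemma integral_swap : \int[m1]_x \int[m2]_y F x y = \int[m2]_y \int[m1]_x F x y.
Proof. exact: (fubini_tonelli (fun p => F p.1 p.2)). Qed.

End iterated.

(** * The inequality on the line and its tensorization *)

Section young_line.
Context {R : realType}.
Local Notation mu := (@lebesgue_measure R).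
Local Notation T := (measurableTypeR R).
Variables (al ep q : R).
Hypotheses (al0 : 0 < al) (al1 : al < 1) (ep0 : 0 < ep) (ep2 : ep <= 1/2)
  (q0 : 0 < q).

(** The gap between [U] and the integral of [u] is the mass of a Gaussian added to [u]; the sum
    divided by [U] is a positive probability density [f] with u <= U f. This is why the bound on [u]
    is strict. *)
Lemma young_line (u w : R -> R) (U W : R) :
  measurable_fun [set: T] u -> (forall x, 0 <= u x) ->
  measurable_fun [set: T] w -> (forall x, 0 <= w x) ->
  (\int[mu]_x (u x)%:E < U%:E)%E -> (\int[mu]_x (w x)%:E < W%:E)%E ->
  (\int[mu]_x \int[mu]_z (u x `^ (1 - al * ep) * w (x + z) `^ ep * normal_pdf 0 q z)%:E <=
   (expR (ep * young_const al ep q) * U `^ (1 - al * ep) * W `^ ep)%:E)%E.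
Proof.
move=> mu_ u0 mw w0 uU wW.
have [? ? ? ?] := And4 al0 al1 ep0 ep2.
have Iu0 : (0 <= \int[mu]_x (u x)%:E)%E by apply: integral_ge0 => x _; rewrite lee_fin.
have Iw0 : (0 <= \int[mu]_x (w x)%:E)%E by apply: integral_ge0 => x _; rewrite lee_fin.
have U0 : 0 < U by rewrite -lte_fin (le_lt_trans Iu0).
have W0 : 0 < W by rewrite -lte_fin (le_lt_trans Iw0).
have Iu_fin : (\int[mu]_x (u x)%:E)%E \is a fin_num.
  by rewrite ge0_fin_numE// (lt_trans uU)// ltry.
pose e := U - fine (\int[mu]_x (u x)%:E)%E.
have e0 : 0 < e by rewrite subr_gt0 -lte_fin fineK.
(* The Gaussian term makes the density positive everywhere, so that the transport
   map is a bijection. *)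
pose f x := (u x + e * normal_pdf 0 1 x) / U.
have [mg g0 Ig] := @gauss_positive_density R.
have mf : measurable_fun [set: T] f.
  by apply: measurable_funM => //; apply: measurable_funD => //; exact: measurable_funM.
have f0 x : 0 < f x by rewrite divr_gt0// ltr_wpDl// mulr_gt0.
have df : positive_density f.
  split => //; under eq_integral do rewrite EFinM.
  rewrite ge0_integralZr//=; last 3 first.
  - by apply/measurable_EFinP; apply: measurable_funD => //; exact: measurable_funM.
  - by move=> x _; rewrite lee_fin addr_ge0// mulr_ge0// ltW.
  - by rewrite lee_fin invr_ge0 ltW.
  under eq_integral do rewrite EFinD EFinM.
  rewrite ge0_integralD//=; last 4 first.
  - by move=> x _; rewrite lee_fin.
  - exact/measurable_EFinP.
  - by move=> x _; rewrite mule_ge0// lee_fin ltW.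
  - by apply: emeasurable_funM => //; exact/measurable_EFinP.
  rewrite ge0_integralZl//=; last 3 first.
  - exact/measurable_EFinP.
  - by move=> x _; rewrite lee_fin ltW.
  - by rewrite lee_fin ltW.
  by rewrite Ig mule1 -[X in (X + _)%E]fineK// -EFinD -EFinM /e subrKC mulfV// gt_eqF.
have [tau [tau_incr tau_surj tauE]] := transport_exists df (@gauss_positive_density R).
have := young_transported al0 al1 ep0 ep2 q0 df mw w0 tau_incr tau_surj tauE W0 (ltW wW).
set p := 1 - al * ep; have p0 : 0 <= p.
  have : al * ep <= 1 * 1 by rewrite ler_pM//; lra.
  by rewrite /p; lra.
have mint (v : R -> R) : measurable_fun [set: T] v -> (forall x, 0 <= v x) ->
    measurable_fun [set: T * T] (fun xz : T * T => (v xz.1 `^ p * w (xz.1 + xz.2) `^ ep * normal_pdf 0 q xz.2)%:E).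
  move=> mv v0; apply/measurable_EFinP; apply: measurable_funM.
    apply: measurable_funM.
      by apply: (measurableT_comp (measurable_powR _)); exact: (measurableT_comp mv).
    apply: (measurableT_comp (measurable_powR _)); apply: (measurableT_comp mw).
    exact: measurable_funD.
  by apply: (measurableT_comp (measurable_normal_pdf _ _)).
have mint1 (v : R -> R) x : measurable_fun [set: T] v -> (forall x, 0 <= v x) ->
    measurable_fun [set: T] (fun z => (v x `^ p * w (x + z) `^ ep * normal_pdf 0 q z)%:E).
  by move=> mv v0; exact: (measurable_fun_pair2 x (mint v mv v0)).
have pos (v : R -> R) x z : (0 <= (v x `^ p * w (x + z) `^ ep * normal_pdf 0 q z)%:E)%E.
  by rewrite lee_fin !mulr_ge0 ?powR_ge0 ?normal_pdf_ge0.
move=> H.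
apply: (@le_trans _ _ ((U `^ p)%:E * \int[mu]_x \int[mu]_z (f x `^ p * w (x + z) `^ ep * normal_pdf 0 q z)%:E)%E).
  have fp x : 0 <= f x by exact: ltW.
  rewrite -ge0_integralZl//; last 3 first.
  - by apply: (@measurable_integral2 _ _ _ _ _ mu (fun x z => (f x `^ p * w (x + z) `^ ep * normal_pdf 0 q z)%:E)); [exact: mint|exact: pos].
  - by move=> x _; apply: integral_ge0 => z _; exact: pos.
  - by rewrite lee_fin powR_ge0.
  apply: ge0_le_integral => //.
  - by move=> x _; apply: integral_ge0 => z _; exact: pos.
  - by apply: (@measurable_integral2 _ _ _ _ _ mu (fun x z => (u x `^ p * w (x + z) `^ ep * normal_pdf 0 q z)%:E)); [exact: mint|exact: pos].
  - apply: measurable_funeM.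
    by apply: (@measurable_integral2 _ _ _ _ _ mu (fun x z => (f x `^ p * w (x + z) `^ ep * normal_pdf 0 q z)%:E)); [exact: mint|exact: pos].
  move=> x _; rewrite -ge0_integralZl//; last 2 first.
  - exact: (mint1 f x mf fp).
  - by rewrite lee_fin powR_ge0.
  apply: ge0_le_integral => //.
  - exact: (mint1 u x mu_ u0).
  - apply: measurable_funeM.
    exact: (mint1 f x mf fp).
  move=> z _; rewrite -EFinM lee_fin !mulrA ler_wpM2r ?normal_pdf_ge0// ler_wpM2r ?powR_ge0//.
  rewrite -powRM//; last by rewrite ltW.
  have ufx : u x <= U * f x.
    by rewrite /f mulrCA mulfV ?gt_eqF// mulr1 lerDl mulr_ge0// ltW.
  by apply: ge0_ler_powR; rewrite ?nnegrE//; exact: le_trans ufx.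
apply: (@le_trans _ _ ((U `^ p)%:E * (expR (ep * young_const al ep q) * W `^ ep)%:E)%E).
  by apply: lee_wpmul2l => //; rewrite lee_fin powR_ge0.
by rewrite -EFinM lee_fin mulrCA mulrA.
Qed.

End young_line.

Section young_tuple.
Context {R : realType}.
Local Notation mu := (@lebesgue_measure R).
Local Notation T := (measurableTypeR R).
Local Notation lam := (lebesgue_tuple R).

Definition addt n (x z : n.-tuple T) : n.-tuple T :=
  [tuple tnth x i + tnth z i | i < n].

Lemma addt_cons n (x z : T) (t r : n.-tuple T) :
  addt (cons_pair (x, t)) (cons_pair (z, r)) = cons_pair (x + z, addt t r).
Proof.
apply: eq_from_tnth => i; rewrite tnth_mktuple.
by case: (unliftP ord0 i) => [j|] ->; rewrite ?tnth0// !tnthS tnth_mktuple.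
Qed.

Lemma measurable_addt d (X : measurableType d) n (f g : X -> n.-tuple T) :
  measurable_fun setT f -> measurable_fun setT g ->
  measurable_fun setT (fun x => addt (f x) (g x)).
Proof.
move=> /measurable_fun_tnthP mf /measurable_fun_tnthP mg.
apply/measurable_fun_tnthP => i.
rewrite (_ : _ \o _ = (fun x => tnth (f x) i + tnth (g x) i)).
  by apply: measurable_funD; [exact: mf|exact: mg].
by apply/funext => x /=; rewrite tnth_mktuple.
Qed.

(* Every slice of u, not just almost every one, has to be integrable for the
   induction hypothesis of young_tuple to apply to it. *)
Fixpoint fin_sections n : (n.-tuple T -> R) -> Prop :=
  match n with
  | 0 => fun=> True
  | m.+1 => fun u => forall x : T,
      (\int[lam m]_t (u (cons_pair (x, t)))%:E < +oo)%E /\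
      fin_sections (fun t => u (cons_pair (x, t)))
  end.

Variables (al ep q : R).
Hypotheses (al0 : 0 < al) (al1 : al < 1) (ep0 : 0 < ep) (ep2 : ep <= 1/2)
  (q0 : 0 < q).

Let p := 1 - al * ep.

Let p0 : 0 <= p.
Proof.
have [? ? ? ?] := And4 al0 al1 ep0 ep2.
have : al * ep <= 1 * 1 by rewrite ler_pM//; lra.
by rewrite /p; lra.
Qed.

Definition young_integrand n (u w : n.-tuple T -> R) (x z : n.-tuple T) :=
  u x `^ p * w (addt x z) `^ ep * gauss_tuple q z.

Lemma young_integrand_ge0 n (u w : n.-tuple T -> R) x z : 0 <= young_integrand u w x z.
Proof. by rewrite !mulr_ge0 ?powR_ge0 ?gauss_tuple_ge0. Qed.

Lemma measurable_young_integrand n (u w : n.-tuple T -> R) :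
  measurable_fun setT u -> measurable_fun setT w ->
  measurable_fun [set: n.-tuple T * n.-tuple T] (fun xz => young_integrand u w xz.1 xz.2).
Proof.
move=> mu_ mw; apply: measurable_funM.
  apply: measurable_funM.
    by apply: (measurableT_comp (measurable_powR _)); exact: (measurableT_comp mu_).
  apply: (measurableT_comp (measurable_powR _)); apply: (measurableT_comp mw).
  exact: measurable_addt.
by exact: (measurableT_comp (measurable_gauss_tuple q (n:=n)) measurable_snd).
Qed.

(** For fixed first coordinates x and z the induction hypothesis bounds the integral over the slices
    by powers of marginals at x and x + z, with the same exponents. What remains is the
    one-dimensional inequality for the marginals, so the constants multiply. *)
Lemma young_tuple n (u w : n.-tuple T -> R) (U W : R) :
  measurable_fun setT u -> (forall x, 0 <= u x) -> fin_sections u ->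
  measurable_fun setT w -> (forall x, 0 <= w x) -> fin_sections w ->
  (\int[lam n]_x (u x)%:E < U%:E)%E -> (\int[lam n]_x (w x)%:E < W%:E)%E ->
  (\int[lam n]_x \int[lam n]_z (young_integrand u w x z)%:E <=
   (expR (n%:R * (ep * young_const al ep q)) * U `^ p * W `^ ep)%:E)%E.
Proof.
elim: n u w U W => [|n IH] u w U W mu_ u0 su mw w0 sw uU wW.
  rewrite mul0r expR0 mul1r.
  have mx x : measurable_fun setT (fun z => (young_integrand u w x z)%:E).
    by apply/measurable_EFinP; exact: (measurable_fun_pair2 x (measurable_young_integrand mu_ mw)).
  rewrite integral_lebesgue_tuple0; last first.
    apply: (@measurable_integral2 _ _ _ _ _ (lam 0) (fun x z => (young_integrand u w x z)%:E)).
      by apply/measurable_EFinP; exact: measurable_young_integrand.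
    by move=> x z; rewrite lee_fin young_integrand_ge0.
  rewrite integral_lebesgue_tuple0//.
  move: uU wW; rewrite !integral_lebesgue_tuple0; last 2 first.
  - exact/measurable_EFinP.
  - exact/measurable_EFinP.
  rewrite !lte_fin lee_fin /young_integrand /gauss_tuple big_ord0 mulr1 => uU wW.
  have -> : addt [tuple] [tuple] = [tuple] by exact: tuple0.
  by rewrite ler_pM ?powR_ge0// ge0_ler_powR ?nnegrE// ltW// (le_lt_trans (u0 _) uU, le_lt_trans (w0 _) wW).
pose Phi := young_integrand u w.
have mPhi : measurable_fun [set: n.+1.-tuple T * n.+1.-tuple T] (fun xz => (Phi xz.1 xz.2)%:E).
  by apply/measurable_EFinP; exact: measurable_young_integrand.
have Phi0 x z : (0 <= (Phi x z)%:E)%E by rewrite lee_fin young_integrand_ge0.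
pose F x t z r := (Phi (cons_pair (x, t)) (cons_pair (z, r)))%:E.
have F0 x t z r : (0 <= F x t z r)%E by exact: Phi0.
have mF d (X : measurableType d) (a b : X -> T) (f g : X -> n.-tuple T) :
    measurable_fun setT a -> measurable_fun setT f ->
    measurable_fun setT b -> measurable_fun setT g ->
    measurable_fun setT (fun s => F (a s) (f s) (b s) (g s)).
  move=> ma mf mb mg.
  apply: (measurableT_comp mPhi (g := fun s => (cons_pair (a s, f s), cons_pair (b s, g s)))).
  by apply: measurable_fun_pair; exact: measurable_cons.
have mIr d (X : measurableType d) (a b : X -> T) (f : X -> n.-tuple T) :
    measurable_fun setT a -> measurable_fun setT f -> measurable_fun setT b ->
    measurable_fun setT (fun s => \int[lam n]_r F (a s) (f s) (b s) r)%E.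
  move=> ma mf mb.
  apply: (@measurable_integral2 _ _ _ _ _ (lam n) (fun s r => F (a s) (f s) (b s) r)) => //.
  by apply: mF => //; exact: measurableT_comp.
have mItr d (X : measurableType d) (a b : X -> T) :
    measurable_fun setT a -> measurable_fun setT b ->
    measurable_fun setT (fun s => \int[lam n]_t \int[lam n]_r F (a s) t (b s) r)%E.
  move=> ma mb.
  apply: (@measurable_integral2 _ _ _ _ _ (lam n) (fun s t => \int[lam n]_r F (a s) t (b s) r)%E).
    by apply: mIr => //; exact: measurableT_comp.
  by move=> s t; apply: integral_ge0.
(* Tonelli brings both first coordinates outside. *)
have -> : (\int[lam n.+1]_x \int[lam n.+1]_z (Phi x z)%:E =
    \int[mu]_x \int[mu]_z \int[lam n]_t \int[lam n]_r F x t z r)%E.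
  rewrite integral_lebesgue_tupleS; last 2 first.
  - by apply: (@measurable_integral2 _ _ _ _ _ (lam n.+1) (fun x z => (Phi x z)%:E)).
  - by move=> x; apply: integral_ge0.
  apply: eq_integral => x _.
  transitivity (\int[lam n]_t \int[mu]_z \int[lam n]_r F x t z r)%E.
    apply: eq_integral => t _; rewrite integral_lebesgue_tupleS//.
    exact: (measurable_fun_pair2 _ mPhi).
  rewrite (@integral_swap _ _ _ _ _ (lam n) mu (fun t z => \int[lam n]_r F x t z r)%E)//.
    by apply: mIr.
  by move=> t z; apply: integral_ge0.
pose C := expR (n%:R * (ep * young_const al ep q)).
(* The marginal is raised by a Gaussian whose mass is half of the gap below [V]: the bound becomes
   strict on every slice, as the induction hypothesis requires, while the total stays below [V]. *)
have key (v : n.+1.-tuple T -> R) V : measurable_fun setT v -> (forall x, 0 <= v x) -> fin_sections v ->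
    (\int[lam n.+1]_x (v x)%:E < V%:E)%E ->
    exists v1 : R -> R, [/\ measurable_fun [set: T] v1, forall x, 0 <= v1 x,
      (\int[mu]_x (v1 x)%:E < V%:E)%E &
      forall x, (\int[lam n]_t (v (cons_pair (x, t)))%:E < (v1 x)%:E)%E].
  move=> mv v0 sv vV.
  pose I x := (\int[lam n]_t (v (cons_pair (x, t)))%:E)%E.
  have I0 x : (0 <= I x)%E by apply: integral_ge0 => t _; rewrite lee_fin.
  have If x : I x \is a fin_num by rewrite ge0_fin_numE//; exact: (sv x).1.
  have mI : measurable_fun [set: T] I.
    apply: (@measurable_integral2 _ _ _ _ _ (lam n) (fun x t => (v (cons_pair (x, t)))%:E)).
      apply/measurable_EFinP; apply: (measurableT_comp mv).
      exact: (measurable_cons measurable_fst measurable_snd).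
    by move=> x t; rewrite lee_fin.
  have IE : (\int[mu]_x I x = \int[lam n.+1]_x (v x)%:E)%E.
    by rewrite integral_lebesgue_tupleS//; exact/measurable_EFinP.
  have II0 : (0 <= \int[mu]_x I x)%E by apply: integral_ge0.
  have IIf : (\int[mu]_x I x)%E \is a fin_num.
    by rewrite ge0_fin_numE// IE (lt_trans vV)// ltry.
  pose e := (V - fine (\int[mu]_x I x)%E) / 2.
  have e0 : 0 < e by rewrite divr_gt0// subr_gt0 -lte_fin fineK// IE.
  have [mg g0 Ig] := @gauss_positive_density R.
  exists (fun x => fine (I x) + e * normal_pdf 0 1 x); split.
  - apply: measurable_funD; last exact: measurable_funM.
    by apply/measurable_EFinP; apply: (eq_measurable_fun I) => // x _ /=; rewrite fineK.
  - by move=> x; rewrite addr_ge0 ?fine_ge0// mulr_ge0// ltW.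
  - under eq_integral do rewrite EFinD EFinM fineK//.
    rewrite ge0_integralD//=; last 2 first.
    + by move=> x _; rewrite mule_ge0// lee_fin ltW.
    + by apply: emeasurable_funM => //; exact/measurable_EFinP.
    rewrite ge0_integralZl//=; last 3 first.
    + exact/measurable_EFinP.
    + by move=> x _; rewrite lee_fin ltW.
    + by rewrite lee_fin ltW.
    rewrite Ig mule1 -[X in (X + _)%E]fineK// -EFinD lte_fin /e.
    have : fine (\int[mu]_x I x)%E < V by rewrite -lte_fin fineK// IE.
    by lra.
  - by move=> x; rewrite -/(I x) -[ltLHS]fineK// lte_fin ltrDl mulr_gt0.
have [u1 [mu1 u10 u1U u1s]] := key u U mu_ u0 su uU.
have [w1 [mw1 w10 w1W w1s]] := key w W mw w0 sw wW.
have mcons x : measurable_fun setT (fun t : n.-tuple T => cons_pair (x, t)).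
  by apply: (@measurable_cons _ _ _ _ (fun=> x) n id).
have inner x z : (\int[lam n]_t \int[lam n]_r F x t z r <=
    C%:E * (u1 x `^ p * w1 (x + z) `^ ep * normal_pdf 0 q z)%:E)%E.
  have H := IH (fun t => u (cons_pair (x, t))) (fun t => w (cons_pair (x + z, t)))
    (u1 x) (w1 (x + z)) (measurableT_comp mu_ (mcons _)) (fun=> u0 _) (su x).2
    (measurableT_comp mw (mcons _)) (fun=> w0 _) (sw (x + z)).2 (u1s x) (w1s (x + z)).
  have mH := measurable_young_integrand (measurableT_comp mu_ (mcons x)) (measurableT_comp mw (mcons (x + z))).
  have -> : (\int[lam n]_t \int[lam n]_r F x t z r = (normal_pdf 0 q z)%:E *
     \int[lam n]_t \int[lam n]_r (young_integrand (fun t => u (cons_pair (x, t)))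
       (fun t => w (cons_pair (x + z, t))) t r)%:E)%E.
    rewrite -ge0_integralZl//; last 3 first.
    - apply: (@measurable_integral2 _ _ _ _ _ (lam n) (fun t r => (young_integrand (fun t => u (cons_pair (x, t)))
       (fun t => w (cons_pair (x + z, t))) t r)%:E)).
        exact/measurable_EFinP.
      by move=> t r; rewrite lee_fin young_integrand_ge0.
    - by move=> t _; apply: integral_ge0 => r _; rewrite lee_fin young_integrand_ge0.
    - by rewrite lee_fin normal_pdf_ge0.
    apply: eq_integral => t _; rewrite -ge0_integralZl//; last 3 first.
    - by apply/measurable_EFinP; exact: (measurable_fun_pair2 t mH).
    - by move=> r _; rewrite lee_fin young_integrand_ge0.
    - by rewrite lee_fin normal_pdf_ge0.
    apply: eq_integral => r _; rewrite -EFinM /F /Phi /young_integrand addt_cons gauss_tuple_cons.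
    by congr EFin; ring.
  apply: (@le_trans _ _ ((normal_pdf 0 q z)%:E * (C * u1 x `^ p * w1 (x + z) `^ ep)%:E)%E).
    by apply: lee_wpmul2l => //; rewrite lee_fin normal_pdf_ge0.
  by rewrite -!EFinM lee_fin [leLHS]mulrC !mulrA.
have C0 : 0 <= C by exact: expR_ge0.
have mR : measurable_fun [set: T * T] (fun xz : T * T =>
    (u1 xz.1 `^ p * w1 (xz.1 + xz.2) `^ ep * normal_pdf 0 q xz.2)%:E).
  apply/measurable_EFinP; apply: measurable_funM.
    apply: measurable_funM.
      by apply: (measurableT_comp (measurable_powR _)); exact: (measurableT_comp mu1).
    apply: (measurableT_comp (measurable_powR _)); apply: (measurableT_comp mw1).
    exact: measurable_funD.
  by apply: (measurableT_comp (measurable_normal_pdf _ _)).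
have R0 x z : (0 <= (u1 x `^ p * w1 (x + z) `^ ep * normal_pdf 0 q z)%:E)%E.
  by rewrite lee_fin !mulr_ge0 ?powR_ge0 ?normal_pdf_ge0.
apply: (@le_trans _ _ (C%:E * \int[mu]_x \int[mu]_z (u1 x `^ p * w1 (x + z) `^ ep * normal_pdf 0 q z)%:E)%E).
  rewrite -ge0_integralZl//; last 2 first.
  - exact: (@measurable_integral2 _ _ _ _ _ mu (fun x z => (u1 x `^ p * w1 (x + z) `^ ep * normal_pdf 0 q z)%:E) mR R0).
  - by move=> x _; exact: integral_ge0.
  apply: ge0_le_integral => //.
  - by move=> x _; do 3 (apply: integral_ge0 => ? _).
  - apply: (@measurable_integral2 _ _ _ _ _ mu (fun x z => \int[lam n]_t \int[lam n]_r F x t z r)%E).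
      exact: mItr.
    by move=> x z; do 2 (apply: integral_ge0 => ? _).
  - apply: measurable_funeM.
    exact: (@measurable_integral2 _ _ _ _ _ mu (fun x z => (u1 x `^ p * w1 (x + z) `^ ep * normal_pdf 0 q z)%:E) mR R0).
  move=> x _; rewrite -ge0_integralZl//; last first.
    exact: (measurable_fun_pair2 x mR).
  apply: ge0_le_integral => //.
  - by move=> z _; do 2 (apply: integral_ge0 => ? _).
  - exact: (@mItr _ _ (fun=> x) id).
  - by apply: measurable_funeM; exact: (measurable_fun_pair2 x mR).
have H := young_line al0 al1 ep0 ep2 q0 mu1 u10 mw1 w10 u1U w1W.
apply: (@le_trans _ _ (C%:E * (expR (ep * young_const al ep q) * U `^ p * W `^ ep)%:E)%E).
  by apply: lee_wpmul2l.
rewrite -EFinM lee_fin /C; set k := ep * young_const al ep q.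
by rewrite -natr1 mulrDl mul1r expRD !mulrA.
Qed.

End young_tuple.

(** * Greedy codebooks *)

Section ball.
Context {R : realType}.
Local Notation mu := (@lebesgue_measure R).
Local Notation T := (measurableTypeR R).
Local Notation lam := (lebesgue_tuple R).

(** Boundedness rather than finite volume, because it passes to every slice, as [fin_sections]
    demands. *)
Definition bounded_tuples n (A : set (n.-tuple T)) :=
  exists r : R, forall t, A t -> forall i, `|tnth t i| <= r.

Lemma bounded_tuples_fin n (A : set (n.-tuple T)) :
  measurable A -> bounded_tuples A -> (lam n A < +oo)%E.
Proof.
move=> mA [r Ar].
apply: (@le_lt_trans _ _ (lam n (tuple_box (fun=> `[- r, r]%classic)))).
  apply: le_measure; rewrite ?inE//; first exact: measurable_tuple_box.
  by move=> t At i /=; rewrite in_itv/= -ler_norml Ar.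
rewrite lebesgue_tuple_box//.
have [v ->] : exists v : R, lebesgue_measure (`[- r, r]%classic : set T) = v%:E.
  exists (fine (lebesgue_measure (`[- r, r]%classic : set T))); rewrite fineK//.
  by rewrite lebesgue_measure_itv/=; case: ifP.
by rewrite prodEFin ltry.
Qed.

Lemma fin_sections_indic n (A : set (n.-tuple T)) :
  measurable A -> bounded_tuples A -> fin_sections (\1_A : n.-tuple T -> R).
Proof.
elim: n A => [//|n IH] A mA bA x /=.
pose Ax : set (n.-tuple T) := [set t | A (cons_pair (x, t))].
have mAx : measurable Ax.
  rewrite -[Ax]setTI; apply: (_ : measurable_fun setT (fun t : n.-tuple T => cons_pair (x, t))) => //.
  by apply: (@measurable_cons _ _ _ _ (fun=> x) n id).
have bAx : bounded_tuples Ax.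
  by case: bA => r Ar; exists r => t /Ar + i => /(_ (lift ord0 i)); rewrite tnthS.
have E : (fun t => \1_A (cons_pair (x, t))) = (\1_Ax : n.-tuple T -> R).
  apply/funext => t; rewrite !indicE.
  suff -> : (t \in Ax) = (cons_pair (x, t) \in A) by [].
  by apply/idP/idP; rewrite !inE.
rewrite E; split; last exact: IH.
have -> : (fun t => (\1_A (cons_pair (x, t)))%:E) = (fun t => (\1_Ax t : R)%:E).
  by apply/funext => t; rewrite -E.
by rewrite integral_indic// setIT; exact: bounded_tuples_fin.
Qed.

Definition tball n (P : R) (x : n.-tuple T) : set (n.-tuple T) :=
  [set y | \sum_(i < n) (tnth y i - tnth x i) ^+ 2 <= n%:R * P].

Lemma measurable_tball n P (x : n.-tuple T) : measurable (tball P x).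
Proof.
have mf : measurable_fun setT (fun y : n.-tuple T => \sum_(i < n) (tnth y i - tnth x i) ^+ 2).
  apply: measurable_sum => i; apply: measurable_funX; apply: measurable_funB => //.
  exact: measurable_tnth.
rewrite (_ : tball P x = (fun y : n.-tuple T => \sum_(i < n) (tnth y i - tnth x i) ^+ 2) @^-1` `]-oo, n%:R * P]).
  by rewrite -[X in measurable X]setTI; apply: mf.
by apply/seteqP; split => y /=; rewrite in_itv.
Qed.

Lemma bounded_tball n P (x : n.-tuple T) : bounded_tuples (tball P x).
Proof.
exists (\sum_(i < n) `|tnth x i| + (n%:R * P + 1)) => y yB i.
have h : (tnth y i - tnth x i) ^+ 2 <= n%:R * P.
  apply: le_trans yB; rewrite (bigD1 i)//= lerDl sumr_ge0// => j _.
  exact: sqr_ge0.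
have h2 : `|tnth y i - tnth x i| <= n%:R * P + 1.
  rewrite -real_normK ?num_real// in h; set v := `|_| in h *.
  by have := sqr_ge0 (v - 1 / 2); nra.
have h3 : `|tnth x i| <= \sum_(j < n) `|tnth x j|.
  by rewrite (bigD1 i)//= lerDl sumr_ge0.
rewrite -[tnth y i](subrK (tnth x i)) (le_trans (ler_normD _ _))// addrC.
exact: lerD.
Qed.

(** On the ball, n/2 - |y - x|^2 / (2 P) is nonnegative, so its exponential dominates the indicator;
    that Gaussian integrates to (2 pi e P)^(n/2). *)
Lemma volume_tball n P (x : n.-tuple T) : 0 < P ->
  (lam n (tball P x) <= (expR (n%:R * ((1 + ln (2 * pi * P)) / 2)))%:E)%E.
Proof.
move=> P0; set k := (1 + ln _) / 2.
have q0 : 0 < Num.sqrt P by rewrite sqrtr_gt0.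
have q2 : Num.sqrt P ^+ 2 = P by rewrite sqr_sqrtr// ltW.
pose F (i : 'I_n) (y : R) := expR k * normal_pdf (tnth x i) (Num.sqrt P) y.
have FE i y : F i y = expR (1 / 2 - (y - tnth x i) ^+ 2 / (2 * P)).
  by rewrite /F normal_pdf_expR// -expRD q2 /k; congr expR; field; rewrite gt_eqF.
have mF i : measurable_fun [set: T] (F i).
  by apply: measurable_funM => //; exact: measurable_normal_pdf.
have F0 i y : 0 <= F i y by rewrite mulr_ge0 ?expR_ge0 ?normal_pdf_ge0.
have mB := measurable_tball P x.
have <- : (\int[lam n]_y (\1_(tball P x) y)%:E = lam n (tball P x))%E.
  by rewrite integral_indic// setIT.
apply: (@le_trans _ _ (\int[lam n]_y (\prod_(i < n) F i (tnth y i))%:E)%E).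
  apply: ge0_le_integral => //.
  - by apply/measurable_EFinP; exact: measurable_indic.
  - by apply/measurable_EFinP; exact: (measurable_prod_tnth (F := F)).
  move=> y _; rewrite lee_fin indicE.
  have [|_] := boolP (y \in tball P x); last by apply: prodr_ge0 => i _.
  rewrite inE /tball/= => yB.
  under eq_bigr do rewrite FE.
  rewrite -expR_sum -[leLHS]expR0 ler_expR big_split/= sumr_const card_ord sumrN -mulr_suml.
  rewrite subr_ge0 ler_pdivrMr ?mulr_gt0// (le_trans yB)//.
  by rewrite -mulr_natl le_eqVlt; apply/orP; left; apply/eqP; field.
rewrite integral_prod_tnth//.
have I i : (\int[mu]_y (F i y)%:E = (expR k)%:E)%E.
  under eq_integral do rewrite EFinM.
  rewrite ge0_integralZl//; last 2 first.
  - by apply/measurable_EFinP; exact: measurable_normal_pdf.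
  - by move=> y _; rewrite lee_fin normal_pdf_ge0.
  by rewrite integral_normal_pdf mule1.
under eq_bigr do rewrite I.
by rewrite prodEFin prodr_const card_ord lee_fin -expRM_natl.
Qed.

Definition zero_tuple n : n.-tuple T := [tuple 0 | i < n].

Lemma noise_outside_ball n nu eta : 0 < nu -> 0 < eta <= 1 ->
  (\int[lam n]_(z in ~` tball (nu * (1 + eta)) (zero_tuple n)) (gauss_tuple (Num.sqrt nu) z)%:E
   <= (expR (- (n%:R * (eta ^+ 2 / 12))))%:E)%E.
Proof.
move=> nu0 /andP[eta0 eta1]; set B := tball _ _.
have q0 : 0 < Num.sqrt nu by rewrite sqrtr_gt0.
have q2 : Num.sqrt nu ^+ 2 = nu by rewrite sqr_sqrtr// ltW.
(* Chernoff bound: for t <= 1/4 each coordinate contributes at most - t eta / 2 + 2 t^2 / 3 to the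
   exponent, which is - eta^2 / 12 for this [t]. *)
pose t := eta / 4.
pose F (z : R) := expR (t / (2 * nu) * (z ^+ 2 - nu * (1 + eta))) * normal_pdf 0 (Num.sqrt nu) z.
have mF : measurable_fun [set: T] F.
  apply: measurable_funM; last exact: measurable_normal_pdf.
  apply: measurableT_comp => //; apply: measurable_funM => //.
  by apply: measurable_funB => //; exact: measurable_funX.
have F0 z : 0 <= F z by rewrite mulr_ge0 ?expR_ge0 ?normal_pdf_ge0.
have mB := measurable_tball (nu * (1 + eta)) (zero_tuple n).
apply: (@le_trans _ _ (\int[lam n]_z (\prod_(i < n) F (tnth z i))%:E)%E).
  rewrite integral_mkcond; apply: ge0_le_integral => //.
  - by move=> z _; rewrite /patch; case: ifP => // _; rewrite lee_fin gauss_tuple_ge0.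
  - apply/(measurable_restrictT _ _).1; first exact: measurableC.
    by apply: measurable_funTS; apply/measurable_EFinP; exact: measurable_gauss_tuple.
  - by apply/measurable_EFinP; apply: (measurable_prod_tnth (F := fun=> F)).
  move=> z _; rewrite /patch; case: ifPn => [|_]; last by rewrite lee_fin prodr_ge0.
  rewrite inE /B /tball/= => /negP; rewrite -ltNge => zB.
  rewrite lee_fin /F big_split/= -expR_sum -[leLHS]mul1r ler_wpM2r ?gauss_tuple_ge0//.
  rewrite -[leLHS]expR0 ler_expR -mulr_sumr mulr_ge0 ?divr_ge0 ?mulr_ge0 ?ltW//.
  rewrite big_split/= sumrN sumr_const card_ord -mulr_natl subr_gt0 (lt_le_trans zB)//.
  apply: ler_sum => i _.
  by rewrite /zero_tuple tnth_mktuple subr0.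
rewrite (integral_prod_tnth (F := fun=> F))//.
have I : (\int[mu]_z (F z)%:E <= (expR (- (eta ^+ 2 / 12)))%:E)%E.
  have t1 : 0 < 1 - t by rewrite /t; lra.
  have E : (\int[mu]_z (F z)%:E = \int[mu]_z ((expR (- (t * (1 + eta) / 2) - ln (2 * pi * nu) / 2))%:E *
      (expR (- ((1 - t) / nu / 2 * z ^+ 2) + 0 * z))%:E))%E.
    apply: eq_integral => z _; rewrite -EFinM /F normal_pdf_expR// -!expRD q2; congr (expR _)%:E.
    by field; rewrite gt_eqF.
  rewrite E ge0_integralZl//; last by apply/measurable_EFinP; exact: measurable_expR_quadratic.
  rewrite integral_expR_quadratic ?divr_gt0// -EFinM -expRD lee_fin ler_expR.
  have -> : 2 * pi / ((1 - t) / nu) = 2 * pi * nu / (1 - t) by field; rewrite !gt_eqF.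
  have pn : 0 < 2 * pi * nu by rewrite !mulr_gt0// pi_gt0.
  rewrite ln_div ?posrE// expr0n mul0r addr0.
  have := @ln_1D_ge R (- t) ltac:(lra).
  have : t / (1 - t) <= t + 4 / 3 * t ^+ 2.
    rewrite ler_pdivrMr//; have : 0 <= t ^+ 2 * (1 / 4 - t).
      by rewrite mulr_ge0 ?sqr_ge0// /t; lra.
    by lra.
  have -> : - t / (1 - t) = - (t / (1 - t)) by rewrite mulNr.
  rewrite /t; lra.
have IF : (\int[mu]_z (F z)%:E)%E \is a fin_num.
  rewrite ge0_fin_numE; last by apply: integral_ge0 => z _; rewrite lee_fin.
  by rewrite (le_lt_trans I)// ltry.
move: I; rewrite -[X in (X <= _)%E]fineK// lee_fin => I.
rewrite (eq_bigr (fun=> (fine (\int[mu]_z (F z)%:E))%:E)); last by move=> i _; rewrite fineK.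
rewrite prodEFin prodr_const card_ord lee_fin -mulrN expRM_natl lerXn2r ?nnegrE ?expR_ge0//.
by rewrite fine_ge0// integral_ge0// => z _; rewrite lee_fin.
Qed.

End ball.

(** * Choice of codewords and decoding *)

Section codebook.
Context {R : realType}.
Local Notation mu := (@lebesgue_measure R).
Local Notation T := (measurableTypeR R).
Local Notation lam := (lebesgue_tuple R).

Lemma measurable_addt_preimage n (x : n.-tuple T) (A : set (n.-tuple T)) :
  measurable A -> measurable (addt x @^-1` A).
Proof.
move=> mA; rewrite -[X in measurable X]setTI.
by apply: (@measurable_addt _ _ _ _ (fun=> x) id) => //; exact: measurable_id.
Qed.

Section young_set.
Variables (al ep q : R).
Hypotheses (al0 : 0 < al) (al1 : al < 1) (ep0 : 0 < ep) (ep2 : ep <= 1/2)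
  (q0 : 0 < q).

(** Positive powers leave indicators unchanged, so the inner integral is the probability that x + Z
    hits [A]. When the conclusion fails, some x in [S] hits [A] with probability below [delta]: the
    next codeword. *)
Lemma young_set n (S A : set (n.-tuple T)) (delta U W : R) :
  measurable S -> bounded_tuples S -> measurable A -> bounded_tuples A ->
  0 <= delta ->
  (forall x, S x -> (delta%:E <= \int[lam n]_(z in addt x @^-1` A) (gauss_tuple q z)%:E)%E) ->
  (lam n S < U%:E)%E -> (lam n A < W%:E)%E ->
  (delta%:E * lam n S <=
   (expR (n%:R * (ep * young_const al ep q)) * U `^ (1 - al * ep) * W `^ ep)%:E)%E.
Proof.
have [? ? ? ?] := And4 al0 al1 ep0 ep2.
move=> mS bS mA bA d0 Sd SU AW.
have p0 : 1 - al * ep != 0.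
  have : al * ep <= 1 * (1 / 2) by rewrite ler_pM//; lra.
  by move=> h; rewrite gt_eqF//; lra.
have pow1 (b : bool) (p : R) : p != 0 -> (b%:R : R) `^ p = b%:R.
  by move=> pn0; case: b; rewrite ?powR1// powR0.
have mIS : measurable_fun setT (\1_S : n.-tuple T -> R) by exact: measurable_indic.
have mIA : measurable_fun setT (\1_A : n.-tuple T -> R) by exact: measurable_indic.
have I1 (B : set (n.-tuple T)) : measurable B ->
    (\int[lam n]_x (\1_B x)%:E = lam n B)%E.
  by move=> mB; rewrite integral_indic// setIT.
apply: (@le_trans _ _ (\int[lam n]_x \int[lam n]_z
    (young_integrand al ep q (\1_S : n.-tuple T -> R) (\1_A : n.-tuple T -> R) x z)%:E)%E); last first.
  apply: young_tuple => //; [exact: fin_sections_indic|exact: fin_sections_indic| |].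
  - by rewrite I1.
  - by rewrite I1.
rewrite -I1// -ge0_integralZl//; last by apply/measurable_EFinP.
apply: ge0_le_integral => //.
- by move=> x _; rewrite mule_ge0// lee_fin.
- by apply: measurable_funeM; exact/measurable_EFinP.
- apply: (@measurable_integral2 _ _ _ _ _ (lam n) (fun x z =>
    (young_integrand al ep q (\1_S : n.-tuple T -> R) (\1_A : n.-tuple T -> R) x z)%:E)).
    by apply/measurable_EFinP; exact: measurable_young_integrand.
  by move=> x z; rewrite lee_fin young_integrand_ge0.
move=> x _; rewrite indicE; have [|_] := boolP (x \in S); last first.
  by rewrite mule0 integral_ge0// => z _; rewrite lee_fin young_integrand_ge0.
rewrite inE mule1 => Sx; apply: (le_trans (Sd _ Sx)).
rewrite integral_mkcond le_eqVlt; apply/orP; left; apply/eqP.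
apply: eq_integral => z _; rewrite /young_integrand !indicE mem_set// pow1// mul1r.
rewrite pow1 ?gt_eqF// /patch.
have -> : (z \in addt x @^-1` A) = (addt x z \in A) by apply/idP/idP; rewrite !inE.
by case: (_ \in A); rewrite ?mul1r ?mul0r.
Qed.

End young_set.

Section greedy.
Variables (n : nat) (q P : R) (S : set (n.-tuple T)) (M : nat) (delta vol : R).
Hypothesis volP : forall x : n.-tuple T, (lam n (tball P x) <= vol%:E)%E.
Hypothesis vol0 : 0 <= vol.
Hypothesis notfull : forall A : set (n.-tuple T), measurable A -> bounded_tuples A ->
  (lam n A <= (M%:R * vol)%:E)%E ->
  exists2 x, S x & (\int[lam n]_(z in addt x @^-1` A) (gauss_tuple q z)%:E < delta%:E)%E.

Definition ball_union (c : nat -> n.-tuple T) m := \big[setU/set0]_(i < m) tball P (c i).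

Lemma measurable_ball_union c m : measurable (ball_union c m).
Proof. by apply: bigsetU_measurable => i _; exact: measurable_tball. Qed.

Lemma bounded_ball_union c m : bounded_tuples (ball_union c m).
Proof.
rewrite /ball_union; elim: m => [|m [r IH]]; first by exists 0; rewrite big_ord0.
have [s Hs] := bounded_tball P (c m).
exists (Num.max r s); rewrite big_ord_recr/= => t [/IH|/Hs] h i.
  by rewrite le_max h.
by rewrite le_max h orbT.
Qed.

Lemma volume_ball_union c m : (lam n (ball_union c m) <= (m%:R * vol)%:E)%E.
Proof.
rewrite /ball_union; elim: m => [|m IH]; first by rewrite big_ord0 measure0 mul0r.
rewrite big_ord_recr; apply: (le_trans (measureU2 _ _ _)).
- by apply: bigsetU_measurable => i _; exact: measurable_tball.
- exact: measurable_tball.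
by rewrite -natr1 mulrDl mul1r EFinD; apply: leeD; [exact: IH|exact: volP].
Qed.

Lemma eq_ball_union c c' m : (forall i, (i < m)%N -> c i = c' i) ->
  ball_union c m = ball_union c' m.
Proof. by move=> h; apply: eq_bigr => i _; rewrite h. Qed.

(** A codeword has to avoid only the balls of its predecessors, because the decoder prefers the
    first ball. Later choices therefore leave earlier conditions intact. *)
Lemma greedy_codebook : exists c : nat -> n.-tuple T, forall m, (m < M)%N ->
  S (c m) /\ (\int[lam n]_(z in addt (c m) @^-1` ball_union c m) (gauss_tuple q z)%:E < delta%:E)%E.
Proof.
suff : forall k, (k <= M)%N -> exists c : nat -> n.-tuple T, forall m, (m < k)%N ->
  S (c m) /\ (\int[lam n]_(z in addt (c m) @^-1` ball_union c m) (gauss_tuple q z)%:E < delta%:E)%E.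
  by move/(_ M (leqnn _)).
elim=> [_|k IH kM]; first by exists (fun=> zero_tuple _).
have [c Hc] := IH (ltnW kM).
have [|||x Sx Hx] := @notfull (ball_union c k).
- exact: measurable_ball_union.
- exact: bounded_ball_union.
- apply: (le_trans (volume_ball_union c k)).
  by rewrite lee_fin ler_wpM2r// ler_nat ltnW.
pose c' i := if i == k then x else c i.
have cc' m : (m <= k)%N -> ball_union c' m = ball_union c m.
  by move=> mk; apply: eq_ball_union => i im; rewrite /c' ltn_eqF// (leq_trans im).
exists c' => m; rewrite ltnS leq_eqVlt => /predU1P[->|mk].
  by rewrite cc'// /c' eqxx.
by rewrite cc' 1?ltnW// /c' ltn_eqF//; exact: Hc.
Qed.

End greedy.

Section decoder.
Variables (n : nat) (B : nat -> set (n.-tuple T)).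
Hypothesis mB : forall i, measurable (B i).

(** The default 0 for outputs outside all balls is a valid message as soon as there is one. *)
Fixpoint first_in (l : seq nat) (y : n.-tuple T) : nat :=
  if l is i :: l' then if y \in B i then i else first_in l' y else 0.

Lemma measurable_first_in l k : measurable [set y | first_in l y = k].
Proof.
have mQ (Q : Prop) : measurable [set y : n.-tuple T | Q].
  have [h|h] := pselect Q.
    by rewrite (_ : mkset _ = setT)//; apply/seteqP; split.
  by rewrite (_ : mkset _ = set0)//; apply/seteqP; split.
elim: l => [|i l IH] /=; first exact: mQ.
rewrite (_ : mkset _ = (B i `&` [set _ | i = k]) `|` (~` B i `&` [set y | first_in l y = k])).
  apply: measurableU.
    by apply: measurableI => //; exact: mQ.
  by apply: measurableI => //; exact: measurableC.
apply/seteqP; split => y /=.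
  by case: ifPn; rewrite ?inE ?notin_setE => By h; [left|right].
by move=> [[By <-]|[By <-]]; [rewrite mem_set|rewrite memNset].
Qed.

Lemma first_in_lt M y : (0 < M)%N -> (first_in (iota 0 M) y < M)%N.
Proof.
move=> M0; have : all (fun i => i < M)%N (iota 0 M).
  by apply/allP => i; rewrite mem_iota.
by elim: (iota 0 M) => [//|i l IH] /= /andP[iM /IH]; case: ifP.
Qed.

Lemma first_inE M m y : (m < M)%N -> B m y -> (forall i, (i < m)%N -> ~ B i y) ->
  first_in (iota 0 M) y = m.
Proof.
move=> mM Bm Bi.
(* The induction needs lists that start at any a <= m. *)
suff H k a : (a <= m)%N -> (m < a + k)%N -> first_in (iota a k) y = m by exact: H.
elim: k a => [a am|k IH a am mk /=]; first by rewrite addn0 ltnNge am.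
move: am; rewrite leq_eqVlt => /predU1P[->|am]; first by rewrite mem_set.
rewrite memNset; last exact: Bi.
by apply: IH => //; rewrite addSn -addnS.
Qed.

End decoder.

Section code_exists.
Context d (Omega : measurableType d) (P : probability Omega R).
Variables (nu sigma rho : R) (Z : nat -> {RV P >-> T}).
Hypothesis noiseZ : awgn_noise nu Z.

Lemma channel_outputE n (x : n.-tuple T) w : channel_output Z x w = addt x (noise_tuple Z n w).
Proof. by apply: eq_from_tnth => i; rewrite !tnth_mktuple. Qed.

Lemma tball_addt n Q (x z : n.-tuple T) : tball Q x (addt x z) = tball Q (zero_tuple n) z.
Proof.
rewrite /tball/=; congr (is_true (_ <= _)); apply: eq_bigr => i _.
by rewrite !tnth_mktuple subr0 addrAC subrr add0r.
Qed.

(** Union bound: an error requires that the noise leave its ball ([e1]) or that the output fall in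
    an earlier ball ([e2]). *)
Lemma code_of_codebook n M Q (c : nat -> n.-tuple T) (e1 e2 : R) : (0 < M)%N ->
  (\int[lam n]_(z in ~` tball Q (zero_tuple n)) (gauss_tuple (Num.sqrt nu) z)%:E <= e1%:E)%E ->
  (forall m, (m < M)%N -> power_set sigma rho (c m) /\
    (\int[lam n]_(z in addt (c m) @^-1` ball_union Q c m) (gauss_tuple (Num.sqrt nu) z)%:E < e2%:E)%E) ->
  exists C : Defs.code sigma rho n M, (error_prob Z C <= (e1 + e2)%:E)%E.
Proof.
case: M => // M _ H1 H2.
pose B i := tball Q (c i).
have mB i : measurable (B i) by exact: measurable_tball.
pose dec y : 'I_M.+1 := inord (first_in B (iota 0 M.+1) y).
have decE y : dec y = first_in B (iota 0 M.+1) y :> nat.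
  by rewrite /dec inordK// first_in_lt.
have mdec m : measurable (dec @^-1` [set m]).
  rewrite (_ : dec @^-1` [set m] = [set y | first_in B (iota 0 M.+1) y = m]).
    exact: measurable_first_in.
  apply/seteqP; split => y /=; first by move=> <-; rewrite decE.
  by move=> h; apply: val_inj; rewrite /= decE.
have cS (m : 'I_M.+1) : power_set sigma rho (c m) by have [] := H2 m (ltn_ord m).
exists (Code cS mdec).
have mN := @measurable_noise_tuple _ _ _ P Z n.
have Em (m : 'I_M.+1) : (P [set w | dec (channel_output Z (c m) w) <> m] <= (e1 + e2)%:E)%E.
  set A1 := ~` tball Q (zero_tuple n).
  set A2 := addt (c m) @^-1` ball_union Q c m.
  have mA1 : measurable A1 by apply: measurableC; exact: measurable_tball.
  have mA2 : measurable A2 by apply: measurable_addt_preimage; exact: measurable_ball_union.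
  have mNA A : measurable A -> measurable (noise_tuple Z n @^-1` A).
    by move=> mA; rewrite -[X in measurable X]setTI; exact: mN.
  apply: (@le_trans _ _ (P (noise_tuple Z n @^-1` A1 `|` noise_tuple Z n @^-1` A2))).
    apply: le_measure; rewrite ?inE.
    - rewrite (_ : mkset _ = noise_tuple Z n @^-1` (~` (addt (c m) @^-1` (dec @^-1` [set m])))).
        by apply: mNA; apply: measurableC; exact: measurable_addt_preimage.
      by apply/seteqP; split => w /=; rewrite channel_outputE.
    - by apply: measurableU; exact: mNA.
    move=> w /= hw; apply: contrapT => /not_orP[/contrapT zB zU]; apply: hw.
    apply: val_inj; rewrite /= decE; apply: first_inE => //.
      by rewrite /B channel_outputE tball_addt.
    move=> i im; rewrite /B channel_outputE => Bi; apply: zU.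
    have : (\bigcup_(k < m) tball Q (c k)) (addt (c m) (noise_tuple Z n w)) by exists i.
    by rewrite bigcup_mkord.
  apply: (le_trans (measureU2 _ _ _)); [exact: mNA|exact: mNA|].
  rewrite EFinD; apply: leeD; first by move: H1; rewrite -(noise_tupleE noiseZ).
  by have [_ /ltW] := H2 m (ltn_ord m); rewrite -(noise_tupleE noiseZ).
rewrite /error_prob/=.
apply: (@le_trans _ _ ((M.+1%:R^-1)%:E * \sum_(m < M.+1) (e1 + e2)%:E)%E).
  apply: lee_wpmul2l; first by rewrite lee_fin invr_ge0.
  by apply: lee_sum => m _; exact: Em.
by rewrite sumEFin sumr_const card_ord -EFinM mulrnAr -mulrnAl -(mulr_natr _^-1) mulVf ?pnatr_eq0// mul1r.
Qed.

End code_exists.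

End codebook.

(** * The volume exponent *)

Section fekete.
Context {R : realType}.
Variable V : nat -> R.
Hypotheses (V0 : forall n, 0 <= V n) (Vsub : forall m n, V (m + n) <= V m * V n).

Let s n : \bar R := ((n%:R^-1)%:E * lne (V n)%:E)%E.

Lemma fekete_bound m : (forall n, 0 < V n) -> (0 < m)%N ->
  exists C : R, forall n, ln (V n) <= n%:R * (ln (V m) / m%:R) + C.
Proof.
move=> Vp m0.
have lsub i j : ln (V (i + j)) <= ln (V i) + ln (V j).
  by rewrite -lnM ?posrE// ler_ln ?posrE// mulr_gt0.
have lmul k r : ln (V (k * m + r)) <= k%:R * ln (V m) + ln (V r).
  elim: k => [|k IH]; first by rewrite mul0n mul0r add0r add0n.
  rewrite mulSn -addnA (le_trans (lsub _ _))// -natr1 mulrDl mul1r.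
  by rewrite [_ + ln (V m)]addrC -addrA lerD2l.
(* Write n = k m + r. The first term pays for replacing k by n / m, the sum for ln V(r) whatever the
   remainder. *)
exists (`|ln (V m)| + \sum_(r < m) `|ln (V r)|) => n.
rewrite {1}(divn_eq n m) (le_trans (lmul _ _))//.
have rm : (n %% m < m)%N by rewrite ltn_mod.
rewrite addrA lerD//; last first.
  rewrite (bigD1 (Ordinal rm))//= (le_trans (ler_norm _))// lerDl sumr_ge0//.
have mR : 0 < m%:R :> R by rewrite ltr0n.
have -> : n%:R * (ln (V m) / m%:R) = (n %/ m)%:R * ln (V m) + (n %% m)%:R / m%:R * ln (V m) :> R.
  rewrite {1}(divn_eq n m) natrD natrM; field; exact: lt0r_neq0.
rewrite -addrA lerDl.
have r1 : 0 <= ((n %% m)%:R / m%:R : R) <= 1.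
  by rewrite divr_ge0//= ler_pdivrMr// mul1r ler_nat ltnW.
case/andP: r1 => r0 r1.
have := ler_norm (- ln (V m)); rewrite normrN => h.
have : (n %% m)%:R / m%:R * `|ln (V m)| <= `|ln (V m)| by rewrite ler_piMl.
have : - `|ln (V m)| <= ln (V m) by lra.
move=> /(ler_wpM2l r0); lra.
Qed.

(** A finite limit is the infimum of ln V(n) / n, hence the bound for every n > 0. The value -oo
    arises when some V(N) is zero, and then all later ones are, or when the infimum is -oo. *)
Lemma fekete : limn s = -oo%E \/
  exists w : R, limn s = w%:E /\ forall n, (0 < n)%N -> expR (n%:R * w) <= V n.
Proof.
have [[N VN]|/forallNP Vn0] := pselect (exists N, V N = 0).
  left; apply/cvg_lim => //; apply: cvg_near_cst; near=> n.
  have Nn : (N <= n)%N by near: n; exact: nbhs_infty_ge.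
  have n0 : (0 < n)%N by near: n; exact: nbhs_infty_gt.
  have Vn : V n = 0.
    apply/eqP; rewrite eq_le V0 andbT -(subnKC Nn).
    by rewrite (le_trans (Vsub _ _))// VN mul0r.
  by rewrite /s Vn le0_lneNy// gt0_muleNy// lte_fin invr_gt0 ltr0n.
have Vp n : 0 < V n by rewrite lt_neqAle V0 andbT eq_sym; apply/eqP.
have sE n : s n = (ln (V n) / n%:R)%:E by rewrite /s lne_EFin// -EFinM mulrC.
pose A := [set ln (V n) / n%:R | n in [set n | (0 < n)%N]].
have A1 : A !=set0 by exists (ln (V 1) / 1%:R); exists 1%N.
have upper m (e : R) : (0 < m)%N -> 0 < e ->
    \forall n \near \oo, ln (V n) / n%:R < ln (V m) / m%:R + e.
  move=> m0 e0; have [C HC] := fekete_bound Vp m0.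
  near=> n.
  have n0 : (0 < n)%N by near: n; exact: nbhs_infty_gt.
  rewrite ltr_pdivrMr ?ltr0n// mulrDl (le_lt_trans (HC n))//.
  rewrite mulrC ltrD2l.
  rewrite -ltr_pdivrMl// mulrC.
  near: n; exact: nbhs_infty_gtr.
have [lbA|nlbA] := pselect (has_lbound A); last first.
  left; apply/cvg_lim => //; apply/cvgeNyPle => B.
  have [m m0 mB] : exists2 m, (0 < m)%N & ln (V m) / m%:R < B - 1.
    apply: contrapT => /forall2NP h; apply: nlbA; exists (B - 1) => _ [m m0 <-].
    by have [//|/negP] := h m; rewrite -leNgt.
  near=> n; rewrite sE lee_fin.
  apply: (@le_trans _ _ (ln (V m) / m%:R + 1)); last by rewrite -lerBrDr ltW.
  by apply/ltW; near: n; exact: upper.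
right; exists (inf A); split; last first.
  move=> n n0; rewrite -[leRHS]lnK ?posrE// ler_expR mulrC -ler_pdivlMr ?ltr0n//.
  by apply: ge_inf => //; exists n.
apply/cvg_lim => //; apply/fine_cvgP; split.
  by near=> n; rewrite sE.
apply/cvgrPdist_lt => e e0.
have [_ [m m0 <-] mA] := inf_adherent (divr_gt0 e0 (ltr0n _ 2)) (conj A1 lbA).
near=> n.
have n0 : (0 < n)%N by near: n; exact: nbhs_infty_gt.
rewrite /= sE/= distrC ger0_norm; last by rewrite subr_ge0; apply: ge_inf => //; exists n.
rewrite ltrBlDl.
have h : ln (V n) / n%:R < ln (V m) / m%:R + e / 2.
  by near: n; apply: upper => //; exact: divr_gt0.
by lra.
Unshelve. all: by end_near. Qed.

End fekete.

(** * The sets S_n and their volume *)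

Section power_set.
Context {R : realType}.
Local Notation mu := (@lebesgue_measure R).
Local Notation T := (measurableTypeR R).
Local Notation lam := (lebesgue_tuple R).

Definition take_tuple m n (t : (m + n).-tuple T) : m.-tuple T :=
  [tuple tnth t (lshift n i) | i < m].
Definition drop_tuple m n (t : (m + n).-tuple T) : n.-tuple T :=
  [tuple tnth t (rshift m i) | i < n].

Lemma measurable_take_tuple m n : measurable_fun setT (@take_tuple m n).
Proof.
apply/measurable_fun_tnthP => i; rewrite (_ : _ \o _ = (fun t => tnth t (lshift n i))).
  exact: measurable_tnth.
by apply/funext => t /=; rewrite tnth_mktuple.
Qed.

Lemma measurable_drop_tuple m n : measurable_fun setT (@drop_tuple m n).
Proof.
apply/measurable_fun_tnthP => i; rewrite (_ : _ \o _ = (fun t => tnth t (rshift m i))).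
  exact: measurable_tnth.
by apply/funext => t /=; rewrite tnth_mktuple.
Qed.

Lemma take_tuple_cons m n (x : T) (t : (m + n).-tuple T) :
  @take_tuple m.+1 n (cons_pair (x, t)) = cons_pair (x, take_tuple t).
Proof.
apply: eq_from_tnth => i; rewrite tnth_mktuple.
case: (unliftP ord0 i) => [j|] ->; rewrite ?tnth0.
  have -> : lshift n (lift ord0 j) = lift ord0 (lshift n j) :> 'I_(m + n).+1 by exact: val_inj.
  by rewrite !tnthS tnth_mktuple.
have -> : lshift n ord0 = ord0 :> 'I_(m + n).+1 by exact: val_inj.
by rewrite tnth0.
Qed.

Lemma drop_tuple_cons m n (x : T) (t : (m + n).-tuple T) :
  @drop_tuple m.+1 n (cons_pair (x, t)) = drop_tuple t.
Proof.
apply: eq_from_tnth => i; rewrite !tnth_mktuple.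
have -> : rshift m.+1 i = lift ord0 (rshift m i) :> 'I_(m + n).+1 by exact: val_inj.
by rewrite tnthS.
Qed.

Lemma integral_take_drop m n (f : m.-tuple T -> \bar R) (g : n.-tuple T -> \bar R) :
  measurable_fun setT f -> measurable_fun setT g ->
  (forall t, 0 <= f t)%E -> (forall t, 0 <= g t)%E ->
  (\int[lam (m + n)]_t (f (take_tuple t) * g (drop_tuple t)) =
   \int[lam m]_t f t * \int[lam n]_t g t)%E.
Proof.
move=> mf mg f0 g0; elim: m f mf f0 => [|m IH] f mf f0.
  rewrite integral_lebesgue_tuple0// -ge0_integralZl//.
  apply: eq_integral => t _; congr (f _ * g _)%E; first exact: tuple0.
  by apply: eq_from_tnth => i; rewrite tnth_mktuple; congr tnth; exact: val_inj.
have mcons (x : T) k : measurable_fun setT (fun t : k.-tuple T => cons_pair (x, t)).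
  by apply: (@measurable_cons _ _ _ _ (fun=> x) k id).
have mfg : measurable_fun setT (fun t : (m.+1 + n).-tuple T => f (take_tuple t) * g (drop_tuple t))%E.
  apply: emeasurable_funM.
    by apply: (measurableT_comp mf); exact: measurable_take_tuple.
  by apply: (measurableT_comp mg); exact: measurable_drop_tuple.
rewrite (@integral_lebesgue_tupleS R (m + n) _ mfg); last by move=> t; rewrite mule_ge0.
rewrite integral_lebesgue_tupleS// -ge0_integralZr//; last 3 first.
- apply: (@measurable_integral2 _ _ _ _ _ (lam m) (fun x t => f (cons_pair (x, t)))) => //.
  apply: (measurableT_comp mf).
  exact: (measurable_cons measurable_fst measurable_snd).
- by move=> x _; exact: integral_ge0.
- exact: integral_ge0.
apply: eq_integral => x _.
rewrite -(IH (fun t => f (cons_pair (x, t))))//; last exact: (measurableT_comp mf (mcons x m)).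
by apply: eq_integral => t _; rewrite take_tuple_cons drop_tuple_cons.
Qed.

Variables (sigma rho : R).
Hypotheses (sigma_ge0 : 0 <= sigma) (rho_ge0 : 0 <= rho).
Local Notation S n := (power_set sigma rho (n:=n)).

Lemma measurable_power_set n : measurable (S n).
Proof.
have mQ (Q : Prop) (A : set (n.-tuple T)) : measurable A -> measurable [set y : n.-tuple T | Q -> A y].
  move=> mA; have [h|h] := pselect Q.
    by rewrite (_ : mkset _ = A)//; apply/seteqP; split => y /= Ay; [exact: Ay|move=> _].
  by rewrite (_ : mkset _ = setT)//; apply/seteqP; split => // y _ /h.
rewrite (_ : S n = \bigcap_k \bigcap_l [set x : n.-tuple T | (k < l)%N -> (l <= n)%N ->
     \sum_(j < n | (k <= j < l)%N) tnth x j ^+ 2 <= sigma + (l - k)%:R * rho]); last first.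
  by apply/seteqP; split => x /= h; [move=> k _ l _|move=> k l]; exact: h.
apply: bigcap_measurable => // k _; apply: bigcap_measurable => // l _.
have mf : measurable_fun setT (fun y : n.-tuple T => \sum_(j < n | (k <= j < l)%N) tnth y j ^+ 2).
  under eq_fun do rewrite big_mkcond/=.
  apply: measurable_sum => i; case: (k <= i < l)%N => //; apply: measurable_funX.
  exact: measurable_tnth.
pose C := [set y : n.-tuple T | \sum_(j < n | (k <= j < l)%N) tnth y j ^+ 2 <= sigma + (l - k)%:R * rho].
have mC : measurable C.
  rewrite (_ : C = (fun y : n.-tuple T => \sum_(j < n | (k <= j < l)%N) tnth y j ^+ 2) @^-1` `]-oo, sigma + (l - k)%:R * rho]).
    by rewrite -[X in measurable X]setTI; apply: mf.
  by apply/seteqP; split => y /=; rewrite in_itv.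
exact: (mQ (k < l)%N _ (mQ (l <= n)%N _ mC)).
Qed.

Lemma bounded_power_set n : bounded_tuples (S n).
Proof.
exists (sigma + rho + 1) => t tS i.
have := tS i i.+1 (leqnn _) (ltn_ord i).
rewrite (big_pred1 i) => [|j]; last by rewrite /= -val_eqE/= ltnS eqn_leq andbC.
rewrite subSnn mul1r => h.
rewrite -real_normK ?num_real// in h; set v := `|_| in h *.
by have := sqr_ge0 (v - 1 / 2); nra.
Qed.

Lemma power_set_total n (x : n.-tuple T) : S n x ->
  \sum_(i < n) tnth x i ^+ 2 <= sigma + n%:R * rho.
Proof.
(* The window from 0 to n is subject to the constraint only if it is nonempty. *)
move=> xS; case: n x xS => [|n] x xS; first by rewrite big_ord0 mul0r addr0.
have := xS 0 n.+1 isT (leqnn _); rewrite subn0; apply: le_trans.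
rewrite le_eqVlt; apply/orP; left; apply/eqP; apply: eq_bigl => i.
by rewrite ltn_ord.
Qed.

Lemma power_set0 n : S n (zero_tuple n).
Proof.
move=> k l _ _; rewrite big1 ?addr_ge0 ?mulr_ge0// => j _.
by rewrite tnth_mktuple expr0n.
Qed.

Lemma power_set_take m n (x : (m + n).-tuple T) : S (m + n) x -> S m (take_tuple x).
Proof.
move=> xS k l kl lm; have := xS k l kl (leq_trans lm (leq_addr _ _)).
apply: le_trans; rewrite big_split_ord/=.
under eq_bigr do rewrite tnth_mktuple.
rewrite lerDl; apply: sumr_ge0 => i _; exact: sqr_ge0.
Qed.

Lemma power_set_drop m n (x : (m + n).-tuple T) : S (m + n) x -> S n (drop_tuple x).
Proof.
move=> xS k l kl lm.
have := xS (m + k)%N (m + l)%N; rewrite ltn_add2l leq_add2l subnDl => /(_ kl lm).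
apply: le_trans; rewrite big_split_ord/=.
rewrite [X in _ <= _ + X](eq_bigl (fun j : 'I_n => (k <= j < l)%N)); last first.
  by move=> j; rewrite leq_add2l ltn_add2l.
under eq_bigr do rewrite tnth_mktuple.
by rewrite lerDr; apply: sumr_ge0 => i _; exact: sqr_ge0.
Qed.

Definition power_volume n : R := fine (lam n (S n)).

Lemma power_volumeE n : (power_volume n)%:E = lam n (S n).
Proof.
rewrite fineK// ge0_fin_numE//; apply: bounded_tuples_fin.
- exact: measurable_power_set.
- exact: bounded_power_set.
Qed.

Lemma power_volume_ge0 n : 0 <= power_volume n.
Proof. exact: fine_ge0. Qed.

(** The constraint depends on a window only through its length, so both pieces of an admissible
    tuple are admissible: S_(m+n) lies in S_m x S_n. *)
Lemma power_volume_sub m n : power_volume (m + n) <= power_volume m * power_volume n.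
Proof.
rewrite -lee_fin EFinM !power_volumeE.
have I k : (\int[lam k]_x (\1_(S k) x)%:E = lam k (S k))%E.
  by rewrite integral_indic// ?setIT//; exact: measurable_power_set.
have mI k : measurable_fun setT (fun x => (\1_(S k) x : R)%:E).
  by apply/measurable_EFinP; apply: measurable_indic; exact: measurable_power_set.
rewrite -!I -integral_take_drop//.
apply: ge0_le_integral => //.
- exact: mI.
- apply: emeasurable_funM.
    by apply: (measurableT_comp (mI m)); exact: measurable_take_tuple.
  by apply: (measurableT_comp (mI n)); exact: measurable_drop_tuple.
move=> x _; rewrite !indicE; have [|_] := boolP (x \in S (m + n)); last first.
  by rewrite -EFinM lee_fin mulr_ge0.
rewrite inE => xS; rewrite !mem_set ?mule1//; first exact: power_set_drop xS.
exact: power_set_take xS.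
Qed.

Lemma volume_exponent_spec : volume_exponent sigma rho = -oo%E \/
  exists w : R, volume_exponent sigma rho = w%:E /\
    forall n, (0 < n)%N -> ((expR (n%:R * w))%:E <= lam n (S n))%E.
Proof.
rewrite /volume_exponent; under eq_fun do rewrite -power_volumeE.
have [->|[w [-> H]]] := fekete power_volume_ge0 power_volume_sub; first by left.
by right; exists w; split=> // n n0; rewrite -power_volumeE lee_fin; exact: H.
Qed.

End power_set.

(** * Achievability *)

Lemma cvg_expRN_natl {R : realType} (k : R) : 0 < k ->
  (fun n => expR (- (n%:R * k))) @ \oo --> (0 : R).
Proof.
move=> k0; under eq_fun do rewrite -mulrN expRM_natl.
apply: cvg_expr; rewrite ger0_norm ?expR_ge0//.
by rewrite expR_lt1 oppr_lt0.
Qed.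

Section achievability.
Context {R : realType}.
Local Notation T := (measurableTypeR R).
Local Notation lam := (lebesgue_tuple R).
Context d (Omega : measurableType d) (P : probability Omega R).
Variables (nu sigma rho : R) (Z : nat -> {RV P >-> T}).
Hypotheses (sigma_ge0 : 0 <= sigma) (rho_ge0 : 0 <= rho) (nu_gt0 : 0 < nu).
Hypothesis noiseZ : awgn_noise nu Z.

Lemma num_messages_gt0 n (r : R) : 0 <= r -> (0 < num_messages n r)%N.
Proof.
move=> r0; rewrite /num_messages truncn_gt0 -[leLHS]expR0 ler_expR.
by rewrite mulr_ge0.
Qed.

Lemma error_prob_ge0 n M (c : Defs.code sigma rho n M) : (0 <= error_prob Z c)%E.
Proof.
by rewrite mule_ge0 ?lee_fin ?invr_ge0// sume_ge0// => m _; exact: measure_ge0.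
Qed.

Lemma constant_code n M : (0 < M)%N -> exists c : Defs.code sigma rho n M, True.
Proof.
case: M => // M _.
have h (m : 'I_M.+1) : power_set sigma rho (zero_tuple n : n.-tuple T) by exact: power_set0.
have md (m : 'I_M.+1) : measurable ((fun=> ord0 : 'I_M.+1) @^-1` [set m] : set (n.-tuple T)).
  by rewrite -[X in measurable X]setTI; rewrite preimage_cst; case: ifP => _; rewrite ?setTI ?setI0.
by exists (Code h md).
Qed.

(** A single message is never decoded wrongly. This covers the exponent -oo and any target rate that
    is not positive. *)
Lemma achievable0 : achievable Z sigma rho 0.
Proof.
have M1 n : num_messages n (0 : R) = 1%N by rewrite /num_messages mulr0 expR0 truncn1.
have E n : exists c : Defs.code sigma rho n (num_messages n (0 : R)), error_prob Z c = 0%E.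
  rewrite M1; have [c _] := @constant_code n 1 isT; exists c.
  rewrite /error_prob big1 ?mule0// => m _.
  rewrite (_ : mkset _ = set0) ?measure0//; apply/seteqP; split => // w /=.
  by case; rewrite !ord1.
exists (fun n => sval (cid (E n))).
rewrite (_ : (fun n => error_prob Z _) = fun=> 0%E); first exact: cvg_cst.
by apply/funext => n; case: cid.
Qed.

Section exponent.
Variable w : R.
Hypothesis volS : forall n, (0 < n)%N ->
  ((expR (n%:R * w))%:E <= lam n (power_set sigma rho (n:=n)))%E.

Definition epi_rate := 2^-1 * ln (1 + expR (2 * w) / (2 * pi * expR 1 * nu)).

Let A := expR (2 * w).
Let B := 2 * pi * expR 1 * nu.
(** The maximizer of al w + (1 - al) h + H(al)/2 with h = ln B / 2 the noise entropy; the maximum is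
    ln(A + B) / 2, and subtracting h leaves [epi_rate]. *)
Let al := A / (A + B).

Let A0 : 0 < A. Proof. exact: expR_gt0. Qed.
Let B0 : 0 < B. Proof. by rewrite !mulr_gt0 ?expR_gt0 ?pi_gt0. Qed.
Let AB0 : 0 < A + B. Proof. exact: addr_gt0. Qed.
Let al0 : 0 < al. Proof. exact: divr_gt0. Qed.
Let al1 : al < 1. Proof. by rewrite ltr_pdivrMr// mul1r ltrDl. Qed.

Let lnB : ln B = 1 + ln (2 * pi * nu).
Proof.
have pn : 0 < 2 * pi * nu by rewrite !mulr_gt0// pi_gt0.
have -> : B = expR 1 * (2 * pi * nu) by rewrite /B; ring.
by rewrite lnM ?posrE ?expR_gt0// expRK.
Qed.

Lemma epi_rateE ep : al * w - young_const al ep (Num.sqrt nu) - (1 + ln (2 * pi * nu)) / 2 =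
  epi_rate - (1 - al) * ep.
Proof.
have -> : epi_rate = (ln (A + B) - ln B) / 2.
  by rewrite /epi_rate -/A -/B -[1](@mulfV _ B) ?gt_eqF// -mulrDl addrC ln_div ?posrE// mulrC.
rewrite /young_const sqr_sqrtr ?(ltW nu_gt0)//.
have -> : ln al = 2 * w - ln (A + B) by rewrite /al ln_div ?posrE// expRK.
have -> : 1 - al = B / (A + B) by rewrite /al; field; rewrite gt_eqF.
have -> : ln (B / (A + B)) = ln B - ln (A + B) by rewrite ln_div ?posrE.
rewrite lnB; set la := ln (A + B); rewrite /al.
field; rewrite gt_eqF//.
Qed.

(** Otherwise [young_set] applies to S_n and [E]. In logarithms the volume V of S_n cancels up to -
    al ep ln V, which is at most - n al ep w, and [epi_rateE] makes the right side at most - 2 n kap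
    + 2, [kap] being the exponent of the claim. Half of the gain serves as error exponent, the other
    half beats the constant 2. *)
Lemma exists_new_codeword n (r ep eta : R) (vol : R) : (0 < n)%N -> 0 <= r ->
  0 < ep -> ep <= 1 / 2 -> 0 < eta ->
  vol = expR (n%:R * ((1 + ln (2 * pi * (nu * (1 + eta)))) / 2)) ->
  2 < n%:R * (ep * (epi_rate - r - ep - eta / 2) / 2) ->
  forall E : set (n.-tuple T), measurable E -> bounded_tuples E ->
  (lam n E <= ((num_messages n r)%:R * vol)%:E)%E ->
  exists2 x, power_set sigma rho x &
    (\int[lam n]_(z in addt x @^-1` E) (gauss_tuple (Num.sqrt nu) z)%:E <
     (expR (- (n%:R * (ep * (epi_rate - r - ep - eta / 2) / 2))))%:E)%E.
Proof.
move=> n0 r0 ep0 ep2 eta0 volE nbig E mE bE volEle.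
set kap := ep * _ / 2 in nbig *.
apply: contrapT => /forall2NP h.
have {}h x : power_set sigma rho x -> ((expR (- (n%:R * kap)))%:E <=
    \int[lam n]_(z in addt x @^-1` E) (gauss_tuple (Num.sqrt nu) z)%:E)%E.
  by move=> Sx; have [//|/negP] := h x; rewrite -leNgt.
have [? ? ?] := And3 al0 al1 nu_gt0.
have q0 : 0 < Num.sqrt nu by rewrite sqrtr_gt0.
pose V := power_volume sigma rho n.
have VE : V%:E = lam n (power_set sigma rho (n:=n)) by rewrite power_volumeE.
have Vw : expR (n%:R * w) <= V by rewrite -lee_fin VE; exact: volS.
have V0 : 0 < V by apply: lt_le_trans Vw; exact: expR_gt0.
have vol0 : 0 < vol by rewrite volE expR_gt0.
pose M := (num_messages n r)%:R : R.
have M0 : 0 < M by rewrite ltr0n num_messages_gt0.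
have Mr : M <= expR (n%:R * r) by rewrite /M truncn_le// expR_ge0.
(* The factors 2 only make the bounds strict. They cost (p + ep) ln 2 <= 2 in the exponent, which is
   the origin of the threshold 2. *)
have SU : (lam n (power_set sigma rho (n:=n)) < (2 * V)%:E)%E.
  by rewrite -VE lte_fin; lra.
have EW : (lam n E < (2 * (M * vol))%:E)%E.
  rewrite (le_lt_trans volEle)// lte_fin; have := mulr_gt0 M0 vol0; rewrite -/M; lra.
have H := young_set al0 al1 ep0 ep2 q0 (@measurable_power_set R sigma rho n) (bounded_power_set sigma rho n)
  mE bE (expR_ge0 _) h SU EW.
move: H; rewrite -VE -EFinM lee_fin.
set K := young_const _ _ _.
set p := 1 - al * ep.
have W0 : 0 < 2 * (M * vol) by rewrite !mulr_gt0.
rewrite -[X in _ * X <= _]lnK ?posrE// -[2 * V]lnK ?posrE ?mulr_gt0// -[2 * (M * vol)]lnK ?posrE//.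
rewrite -!expRM -!expRD ler_expR => H.
have lV : n%:R * w <= ln V by rewrite -[leLHS]expRK ler_ln ?posrE ?expR_gt0.
have lM : ln M <= n%:R * r by rewrite -[leRHS]expRK ler_ln ?posrE ?expR_gt0.
have l2 : ln (2 : R) <= 1 by have := @le_ln1Dx R 1 ltac:(lra).
have l2' : 0 <= ln (2 : R) by rewrite ln_ge0// ler1n.
have lvol : ln vol = n%:R * ((1 + ln (2 * pi * nu) + ln (1 + eta)) / 2).
  rewrite volE expRK; have pn : 0 < 2 * pi * nu by rewrite !mulr_gt0// pi_gt0.
  have e1 : 0 < 1 + eta by rewrite addr_gt0.
  by rewrite [2 * pi * (nu * _)]mulrA lnM ?posrE// addrA.
have leta : ln (1 + eta) <= eta by apply: le_ln1Dx; rewrite (lt_trans _ eta0)// ltrN10.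
move: H; rewrite (lnM (x := 2)) ?posrE// (lnM (x := 2)) ?posrE ?mulr_gt0// lnM ?posrE// lvol => H.
have E1 := epi_rateE ep; rewrite -/K in E1.
have nR : 0 < n%:R :> R by rewrite ltr0n.
have alep : 0 <= al * ep by rewrite mulr_ge0// ltW.
have alep1 : al * ep <= 1 * 1 by rewrite ler_pM//; lra.
have H1 : al * ep * (n%:R * w) <= al * ep * ln V by rewrite ler_wpM2l.
have H2 : ep * ln M <= ep * (n%:R * r) by rewrite ler_wpM2l// ltW.
have H3 : ep * (n%:R * ln (1 + eta)) <= ep * (n%:R * eta).
  by rewrite ler_pM2l// ler_pM2l.
have H4 : n%:R * (ep * ((1 - al) * ep)) <= n%:R * (ep * ep).
  rewrite ler_pM2l// ler_pM2l//; have : 0 <= al * ep by []. lra.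
have H5 : (p + ep) * ln 2 <= 2 * 1.
  by rewrite ler_pM// /p; lra.
have E2 : n%:R * ep * (al * w) - n%:R * ep * K - n%:R * ep * ((1 + ln (2 * pi * nu)) / 2) =
    n%:R * ep * epi_rate - n%:R * (ep * ((1 - al) * ep)).
  by rewrite -!mulrBr E1; ring.
move: nbig H H1 H2 H3 H4 H5 E2; rewrite /kap /p; clear E1 alep alep1 leta lvol lV.
move: epi_rate (ln V) (ln M) (ln 2) (ln (1 + eta)) (ln (2 * pi * nu)) K al => C lv lm l2_ le L K_ al_.
move=> nbig H H1 H2 H3 H4 H5 E2.

clear -nbig H H1 H2 H3 H4 H5 E2. lra.
Qed.

Lemma achievable_epi r : 0 <= r -> r < epi_rate -> achievable Z sigma rho r.
Proof.
move=> r0 rC.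
have nu0 := nu_gt0.
pose D := epi_rate - r.
have D0 : 0 < D by rewrite subr_gt0.
(* Then D - ep - eta / 2 >= D / 2, so [kap] is positive. *)
pose ep := Num.min (1 / 2) (D / 4); pose eta := Num.min 1 (D / 2).
have ep0 : 0 < ep by rewrite lt_min; apply/andP; split; lra.
have eta0 : 0 < eta by rewrite lt_min; apply/andP; split; lra.
have ep2 : ep <= 1 / 2 by rewrite ge_min lexx.
have epD : ep <= D / 4 by rewrite ge_min lexx orbT.
have eta1 : eta <= 1 by rewrite ge_min lexx.
have etaD : eta <= D / 2 by rewrite ge_min lexx orbT.
pose kap := ep * (epi_rate - r - ep - eta / 2) / 2.
have kap0 : 0 < kap by rewrite divr_gt0// mulr_gt0// -/D; lra.
pose err n : R := expR (- (n%:R * (eta ^+ 2 / 12))) + expR (- (n%:R * kap)).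
(* The bound holds only for large n, but a code is due for each n; small lengths get a constant
   code. *)
have H n : exists c : Defs.code sigma rho n (num_messages n r),
    ((0 < n)%N -> 2 < n%:R * kap -> (error_prob Z c <= (err n)%:E)%E).
  have M0 := num_messages_gt0 n r0.
  have [n0|n0] := leqP n 0.
    by have [c _] := constant_code n M0; exists c.
  have [nk|nk] := leP (n%:R * kap) 2.
    by have [c _] := constant_code n M0; exists c.
  have P0 : 0 < nu * (1 + eta) by rewrite mulr_gt0//; lra.
  have [c Hc] := greedy_codebook (fun x : n.-tuple T => volume_tball x P0) (expR_ge0 _)
    (exists_new_codeword n0 r0 ep0 ep2 eta0 erefl nk).
  have eta01 : 0 < eta <= 1 by rewrite eta0.
  have [C HC] := code_of_codebook noiseZ M0 (noise_outside_ball n nu0 eta01) Hc.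
  by exists C.
exists (fun n => sval (cid (H n))).
have cerr : (err n)%:E @[n --> \oo] --> 0%E.
  apply: cvg_EFin; first by near=> n.
  rewrite -[X in _ --> X]addr0; apply: cvgD; apply: cvg_expRN_natl => //.
  by rewrite divr_gt0// exprn_gt0.
apply: (@squeeze_cvge _ _ _ _ (fun=> 0%E) _ (fun n => (err n)%:E)) => //; last exact: cvg_cst.
near=> n; rewrite error_prob_ge0/=; case: cid => c /= -> //.
- by near: n; exact: nbhs_infty_gt.
- rewrite -ltr_pdivrMr//; near: n; exact: nbhs_infty_gtr.
Unshelve. all: by end_near. Qed.

End exponent.

End achievability.

(** * Converse *)

Section converse.
Context {R : realType}.
Local Notation mu := (@lebesgue_measure R).
Local Notation T := (measurableTypeR R).
Local Notation lam := (lebesgue_tuple R).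

Lemma integral_addt n (x : n.-tuple T) (F : n.-tuple T -> \bar R) :
  measurable_fun setT F -> (forall y, 0 <= F y)%E ->
  (\int[lam n]_z F (addt x z) = \int[lam n]_z F z)%E.
Proof.
elim: n x F => [|n IH] x F mF F0.
  by apply: eq_integral => z _; congr F; apply: eq_from_tnth => -[].
case/tupleP: x => x0 t; change (cons_tuple x0 t) with (cons_pair (x0, t)).
have mFx y : measurable_fun setT (fun r : n.-tuple T => F (cons_pair (y, r))).
  apply: measurableT_comp => //.
  by apply: (@measurable_cons _ _ _ _ (fun=> y) n id).
rewrite !integral_lebesgue_tupleS//; last first.
  apply: measurableT_comp => //.
  apply: (@measurable_addt _ _ _ _ (fun=> cons_pair (x0, t)) id) => //; exact: measurable_id.
pose H u := (\int[lam n]_r F (cons_pair (u, r)))%E.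
have mH : measurable_fun setT H.
  apply: (@measurable_integral2 _ _ _ _ _ (lam n) (fun u r => F (cons_pair (u, r)))) => //.
  apply: measurableT_comp => //.
  exact: (measurable_cons measurable_fst measurable_snd).
have H0 u : (0 <= H u)%E by exact: integral_ge0.
have := ge0_integral_affine x0 ltr01 mH H0; rewrite invr1 mul1e => <-.
apply: eq_integral => y _; under eq_integral do rewrite addt_cons.
by rewrite (IH t (fun r => F (cons_pair (x0 + y, r))))// mul1r addrC.
Qed.

Section tilt.
Variables (nu rho eps : R).
Hypotheses (rho_ge0 : 0 <= rho) (nu_gt0 : 0 < nu) (eps0 : 0 < eps).

Let b := (rho + nu)^-1.
Let rn0 : 0 < rho + nu. Proof. exact: ltr_wpDl. Qed.
Let b0 : 0 < b. Proof. by rewrite invr_gt0. Qed.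

(** With y = x + z and C the claimed rate, this is ln(p_x(y) / q(y)) - (C + eps) for one
    coordinate. *)
Definition log_gap (x z : R) :=
  b / 2 * x ^+ 2 + b * x * z - (nu^-1 - b) / 2 * z ^+ 2 - eps.

Lemma normal_pdf_log_gap x z :
  normal_pdf 0 (Num.sqrt nu) z =
  expR (2^-1 * ln (1 + rho / nu) + eps) * normal_pdf 0 (Num.sqrt (rho + nu)) (x + z) *
  expR (log_gap x z).
Proof.
rewrite !normal_pdf_expR ?sqrtr_gt0// !sqr_sqrtr ?ltW// -!expRD; congr expR.
have := @pi_gt0 R; move: (pi : R) => p p0.
have -> : 1 + rho / nu = (2 * p * (rho + nu)) / (2 * p * nu).
  by field; rewrite !gt_eqF.
rewrite ln_div ?posrE ?mulr_gt0//.
rewrite /log_gap /b; field; rewrite !gt_eqF//.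
Qed.

(* The tilting parameter of the Chernoff bound is eps itself. *)
Definition tilted (x z : R) := expR (eps * log_gap x z) * normal_pdf 0 (Num.sqrt nu) z.

Lemma tilted_ge0 x z : 0 <= tilted x z.
Proof. by rewrite mulr_ge0 ?expR_ge0 ?normal_pdf_ge0. Qed.

Lemma measurable_tilted x : measurable_fun [set: T] (tilted x).
Proof.
apply: measurable_funM; last exact: measurable_normal_pdf.
apply: measurableT_comp => //; apply: measurable_funM => //.
apply: measurable_funB => //; apply: measurable_funB => //.
  by apply: measurable_funD => //; exact: measurable_funM.
by apply: measurable_funM => //; exact: measurable_funX.
Qed.

Definition tilt_bound (x : R) :=
  expR ((eps * b + eps ^+ 2 * b ^+ 2 * nu) / 2 * x ^+ 2 -
    (eps * b * rho - (eps * b * rho) ^+ 2) / 2 - eps ^+ 2).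

(** The integral is Gaussian with precision (1 + u) / nu, where u = eps b rho. Its exact value is
    relaxed by 1 + u >= 1 and ln(1 + u) >= u - u^2. *)
Lemma integral_tilted x : (\int[mu]_z (tilted x z)%:E <= (tilt_bound x)%:E)%E.
Proof.
have [? ? ? ?] := And4 rho_ge0 nu_gt0 eps0 b0.
have pi0 := @pi_gt0 R.
pose u := eps * b * rho.
have u0 : 0 <= u by rewrite /u mulr_ge0 ?mulr_ge0 ?(ltW eps0) ?(ltW b0).
have bE : b * rho = nu * (nu^-1 - b) by rewrite /b; field; rewrite !gt_eqF.
have u1 : 0 < 1 + u by lra.
have E : (\int[mu]_z (tilted x z)%:E = \int[mu]_z
    ((expR (eps * (b / 2 * x ^+ 2 - eps) - ln (2 * pi * nu) / 2))%:E *
     (expR (- ((1 + u) / nu / 2 * z ^+ 2) + (eps * b * x) * z))%:E))%E.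
  apply: eq_integral => z _; rewrite -EFinM /tilted normal_pdf_expR ?sqrtr_gt0// -!expRD.
  rewrite sqr_sqrtr ?ltW//; congr (expR _)%:E.
  by rewrite /log_gap /u -[eps * b * rho]mulrA bE; field; rewrite gt_eqF.
rewrite E ge0_integralZl//; last by apply/measurable_EFinP; exact: measurable_expR_quadratic.
rewrite integral_expR_quadratic ?divr_gt0// -EFinM -expRD lee_fin ler_expR.
have -> : 2 * pi / ((1 + u) / nu) = 2 * pi * nu / (1 + u).
  by move: (pi : R) => p; field; rewrite !gt_eqF.
rewrite ln_div ?posrE ?mulr_gt0//.
have H1 : u - u ^+ 2 <= ln (1 + u).
  apply: le_trans (ln_1D_ge _); last by lra.
  rewrite ler_pdivlMr//; have : 0 <= u ^+ 2 * u by rewrite mulr_ge0 ?sqr_ge0.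
  lra.
have H2 : (eps * b * x) ^+ 2 / (2 * ((1 + u) / nu)) <= eps ^+ 2 * b ^+ 2 * nu / 2 * x ^+ 2.
  have -> : (eps * b * x) ^+ 2 / (2 * ((1 + u) / nu)) =
      (eps ^+ 2 * b ^+ 2 * nu / 2 * x ^+ 2) / (1 + u) by field; rewrite !gt_eqF.
  rewrite ler_pdivrMr// ler_peMr ?lerDl//.
  by rewrite mulr_ge0 ?sqr_ge0// divr_ge0// mulr_ge0 ?(ltW nu_gt0)// mulr_ge0 ?sqr_ge0.
rewrite -/u; lra.
Qed.

Lemma gauss_tuple_log_gap n (x z : n.-tuple T) :
  gauss_tuple (Num.sqrt nu) z <=
  expR (n%:R * (2^-1 * ln (1 + rho / nu) + eps)) * gauss_tuple (Num.sqrt (rho + nu)) (addt x z) +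
  \prod_(i < n) tilted (tnth x i) (tnth z i).
Proof.
set C := 2^-1 * _ + eps.
pose S := \sum_(i < n) log_gap (tnth x i) (tnth z i).
have E1 : gauss_tuple (Num.sqrt nu) z =
    expR (n%:R * C) * gauss_tuple (Num.sqrt (rho + nu)) (addt x z) * expR S.
  rewrite expRM_natl -[X in _ ^+ X]card_ord -prodr_const /S expR_sum -!big_split/=.
  by apply: eq_bigr => i _; rewrite tnth_mktuple -normal_pdf_log_gap.
have E2 : \prod_(i < n) tilted (tnth x i) (tnth z i) = expR (eps * S) * gauss_tuple (Num.sqrt nu) z.
  by rewrite mulr_sumr expR_sum -big_split.
(* Each term on the right dominates alone, according to the sign of [S]. *)
have [S0|S0] := leP S 0.
  rewrite {1}E1 -[leLHS]addr0 lerD//; last first.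
    by apply: prodr_ge0 => i _; exact: tilted_ge0.
  by rewrite ler_piMr ?mulr_ge0 ?expR_ge0 ?gauss_tuple_ge0// -expR0 ler_expR.
rewrite -[leLHS]add0r E2 lerD ?mulr_ge0 ?expR_ge0 ?gauss_tuple_ge0//.
by rewrite ler_peMl ?gauss_tuple_ge0// -expR0 ler_expR mulr_ge0// ltW.
Qed.

(** Under the power constraint the terms of first order in [eps] cancel, except for a contribution
    of [sigma] independent of n. Those of second order add up to at most eps^2 / 2 per coordinate,
    against the margin - eps^2 that comes from [log_gap]. *)
Lemma integral_prod_tilted n (x : n.-tuple T) sigma :
  \sum_(i < n) tnth x i ^+ 2 <= sigma + n%:R * rho ->
  (\int[lam n]_z (\prod_(i < n) tilted (tnth x i) (tnth z i))%:E <=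
   (expR ((eps * b + eps ^+ 2 * b ^+ 2 * nu) / 2 * sigma - n%:R * (eps ^+ 2 / 2)))%:E)%E.
Proof.
move=> xP; have [? ? ?] := And3 rho_ge0 nu_gt0 eps0.
rewrite (integral_prod_tnth (F := fun i => tilted (tnth x i))); last 2 first.
- by move=> i; exact: measurable_tilted.
- by move=> i y; exact: tilted_ge0.
have IF i : (\int[mu]_z (tilted (tnth x i) z)%:E)%E \is a fin_num.
  rewrite ge0_fin_numE; last by apply: integral_ge0 => z _; rewrite lee_fin tilted_ge0.
  by rewrite (le_lt_trans (integral_tilted _))// ltry.
rewrite (eq_bigr (fun i => (fine (\int[mu]_z (tilted (tnth x i) z)%:E))%:E)); last by move=> i _; rewrite fineK.
rewrite prodEFin lee_fin.
apply: (@le_trans _ _ (\prod_(i < n) tilt_bound (tnth x i))).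
  apply: ler_prod => i _; rewrite fine_ge0 ?integral_ge0//=; last first.
    by move=> z _; rewrite lee_fin tilted_ge0.
  by rewrite -lee_fin fineK// integral_tilted.
rewrite -expR_sum ler_expR 2!sumrB -mulr_sumr !sumr_const card_ord -(mulr_natl (_ / 2)) -(mulr_natl (eps ^+ 2)).
set k := (_ + _) / 2.
have k0 : 0 <= k by rewrite divr_ge0// addr_ge0// ?mulr_ge0 ?sqr_ge0 ?ltW.
have H : k * \sum_(i < n) tnth x i ^+ 2 <= k * (sigma + n%:R * rho) by rewrite ler_wpM2l.
have brn : b * (rho + nu) = 1 by rewrite /b mulVf// gt_eqF.
have br1 : b * rho <= 1 by rewrite -brn ler_wpM2l ?ltW// ltrDl.
have G : n%:R * (eps ^+ 2 * (b * rho)) <= n%:R * (eps ^+ 2 * 1).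
  by rewrite ler_wpM2l// ler_wpM2l// sqr_ge0.
have E : k * rho - (eps * b * rho - (eps * b * rho) ^+ 2) / 2 = eps ^+ 2 * (b * rho) / 2.
  transitivity (eps ^+ 2 * (b * rho) / 2 * (b * (rho + nu))); last by rewrite brn mulr1.
  by rewrite /k; ring.
have E' : n%:R * (k * rho) - n%:R * ((eps * b * rho - (eps * b * rho) ^+ 2) / 2) =
    n%:R * (eps ^+ 2 * (b * rho)) / 2 by rewrite -mulrBr E; ring.
lra.
Qed.

End tilt.

End converse.

(** * From the density comparison to the error probability *)

Section converse_bound.
Context {R : realType}.
Local Notation mu := (@lebesgue_measure R).
Local Notation T := (measurableTypeR R).
Local Notation lam := (lebesgue_tuple R).
Context d (Omega : measurableType d) (P : probability Omega R).
Variables (nu sigma rho : R) (Z : nat -> {RV P >-> T}).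
Hypotheses (sigma_ge0 : 0 <= sigma) (rho_ge0 : 0 <= rho) (nu_gt0 : 0 < nu).
Hypothesis noiseZ : awgn_noise nu Z.

Definition awgn_rate := 2^-1 * ln (1 + rho / nu).

Definition tail_bound eps n :=
  expR ((eps / (rho + nu) + eps ^+ 2 * (rho + nu)^-1 ^+ 2 * nu) / 2 * sigma - n%:R * (eps ^+ 2 / 2)).

Lemma measurable_output_event n (x : n.-tuple T) (D : set (n.-tuple T)) : measurable D ->
  measurable [set w | D (channel_output Z x w)].
Proof.
move=> mD; rewrite (_ : mkset _ = setT `&` noise_tuple Z n @^-1` (addt x @^-1` D)); last first.
  by rewrite setTI; apply/seteqP; split => w /=; rewrite channel_outputE.
apply: measurable_noise_tuple => //; exact: measurable_addt_preimage.
Qed.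

Lemma output_event_le n (x : n.-tuple T) (D : set (n.-tuple T)) eps : 0 < eps ->
  measurable D -> power_set sigma rho x ->
  (P [set w | D (channel_output Z x w)] <=
   (expR (n%:R * (awgn_rate + eps)))%:E *
     \int[lam n]_(y in D) (gauss_tuple (Num.sqrt (rho + nu)) y)%:E + (tail_bound eps n)%:E)%E.
Proof.
move=> eps0 mD xP; set K := expR _.
have mxD := measurable_addt_preimage x mD.
have mg q : measurable_fun setT (fun y : n.-tuple T => (gauss_tuple q y)%:E).
  by apply/measurable_EFinP; exact: measurable_gauss_tuple.
have -> : [set w | D (channel_output Z x w)] = noise_tuple Z n @^-1` (addt x @^-1` D).
  by apply/seteqP; split => w /=; rewrite channel_outputE.
rewrite (noise_tupleE noiseZ)//.
pose F (z : n.-tuple T) := (\prod_(i < n) tilted nu rho eps (tnth x i) (tnth z i))%:E.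
have mF : measurable_fun setT F.
  apply/measurable_EFinP; apply: (measurable_prod_tnth (F := fun i => tilted nu rho eps (tnth x i))) => i.
  exact: measurable_tilted.
have F0 z : (0 <= F z)%E.
  by rewrite lee_fin; apply: prodr_ge0 => i _; exact: tilted_ge0.
pose G (z : n.-tuple T) := (K%:E * (gauss_tuple (Num.sqrt (rho + nu)) (addt x z))%:E)%E.
have mG : measurable_fun setT G.
  apply: measurable_funeM; apply: (measurableT_comp (mg _)).
  by apply: (@measurable_addt _ _ _ _ (fun=> x) id) => //; exact: measurable_id.
have G0 z : (0 <= G z)%E.
  by rewrite mule_ge0// lee_fin ?expR_ge0 ?gauss_tuple_ge0.
apply: (@le_trans _ _ (\int[lam n]_(z in addt x @^-1` D) (G z + F z))%E).
  apply: ge0_le_integral => //.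
  - by move=> z _; rewrite lee_fin gauss_tuple_ge0.
  - by apply: measurable_funTS; exact: mg.
  - by apply: measurable_funTS; apply: emeasurable_funD.
  move=> z _; rewrite /G /F -EFinM -EFinD lee_fin.
  exact: gauss_tuple_log_gap.
rewrite ge0_integralD//; last 2 first.
- exact: measurable_funTS.
- exact: measurable_funTS.
apply: leeD; last first.
  apply: (@le_trans _ _ (\int[lam n]_z F z)%E); first exact: ge0_subset_integral.
  exact: (integral_prod_tilted rho_ge0 nu_gt0 eps0 (power_set_total sigma_ge0 xP)).
rewrite ge0_integralZl//; last 3 first.
- apply: measurable_funTS; apply: (measurableT_comp (mg _)).
  by apply: (@measurable_addt _ _ _ _ (fun=> x) id) => //; exact: measurable_id.
- by move=> z _; rewrite lee_fin gauss_tuple_ge0.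
- by rewrite lee_fin expR_ge0.
apply: lee_wpmul2l; first by rewrite lee_fin expR_ge0.
(* Translation by [x] passes from the noise to the output. *)
rewrite [leLHS]integral_mkcond [leRHS]integral_mkcond.
set H := (X in (_ <= \int[_]_z X z)%E).
have mH : measurable_fun setT H.
  apply/(measurable_restrictT _ _).1 => //; exact: measurable_funTS.
have H0 y : (0 <= H y)%E.
  by rewrite /H /patch; case: ifP => // _; rewrite lee_fin gauss_tuple_ge0.
by rewrite -(integral_addt x mH H0).
Qed.

Lemma sum_integral_decode n M (dec : n.-tuple T -> 'I_M) (f : n.-tuple T -> \bar R) :
  (forall m, measurable (dec @^-1` [set m])) ->
  measurable_fun setT f -> (forall y, 0 <= f y)%E ->
  (\sum_(m < M) \int[lam n]_(y in dec @^-1` [set m]) f y = \int[lam n]_y f y)%E.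
Proof.
move=> mdec mf f0.
under eq_bigr do rewrite integral_mkcond.
rewrite -ge0_integral_sum//; last 2 first.
- move=> m; apply/(measurable_restrictT _ _).1 => //; exact: measurable_funTS.
- by move=> m y _; rewrite /patch; case: ifP.
apply: eq_integral => y _; rewrite (bigD1 (dec y))//= /patch mem_set// big1 ?adde0// => m mdy.
by rewrite memNset//= => /esym /eqP; rewrite (negbTE mdy).
Qed.

Lemma error_prob_converse n M (c : Defs.code sigma rho n M) eps : (0 < M)%N -> 0 < eps ->
  (1 <= error_prob Z c + (expR (n%:R * (awgn_rate + eps)) / M%:R + tail_bound eps n)%:E)%E.
Proof.
move=> M0 eps0; set K := expR _; set t := tail_bound _ _.
have M0' : 0 < M%:R :> R by rewrite ltr0n.
pose D m := Defs.decode c @^-1` [set m].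
pose p m := P [set w | D m (channel_output Z (Defs.encode c m) w)].
pose I m := (\int[lam n]_(y in D m) (gauss_tuple (Num.sqrt (rho + nu)) y)%:E)%E.
have mp m : measurable [set w | D m (channel_output Z (Defs.encode c m) w)].
  by apply: measurable_output_event; exact: decode_measurable.
have pfin m : p m \is a fin_num by exact: fin_num_measure.
have S1 : (\sum_(m < M) I m = 1)%E.
  rewrite sum_integral_decode ?integral_gauss_tuple//.
  - exact: decode_measurable.
  - by apply/measurable_EFinP; exact: measurable_gauss_tuple.
  - by move=> y; rewrite lee_fin gauss_tuple_ge0.
have S2 : (\sum_(m < M) p m <= K%:E + (M%:R * t)%:E)%E.
  apply: (@le_trans _ _ (\sum_(m < M) (K%:E * I m + t%:E))%E).
    apply: lee_sum => m _; apply: output_event_le => //.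
      exact: decode_measurable.
    exact: encode_power.
  rewrite big_split/= sumEFin sumr_const card_ord -ge0_sume_distrr; last first.
    by move=> m _; apply: integral_ge0 => y _; rewrite lee_fin gauss_tuple_ge0.
  by rewrite S1 mule1 mulr_natl.
have Ep : (\sum_(m < M) p m = (\sum_(m < M) fine (p m))%:E)%E.
  by rewrite -sumEFin; apply: eq_bigr => m _; rewrite fineK.
have E : (\sum_(m < M) P [set w | Defs.decode c (channel_output Z (Defs.encode c m) w) <> m] =
    (M%:R)%:E - \sum_(m < M) p m)%E.
  rewrite Ep.
  rewrite -EFinB.
  have -> : (M%:R - \sum_(m < M) fine (p m))%R = \sum_(m < M) (1 - fine (p m)) :> R.
    by rewrite big_split/= sumr_const card_ord sumrN.
  rewrite -sumEFin; apply: eq_bigr => m _.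
  by rewrite EFinB fineK// -probability_setC.
rewrite /error_prob E.
move: S2; rewrite Ep; set s := \sum_(m < M) _; rewrite -EFinD lee_fin => S2.
rewrite -EFinB -EFinM -EFinD lee_fin.
rewrite -(ler_pM2l M0') mulr1 mulrDr mulrA mulfV ?gt_eqF// mul1r mulrDr.
rewrite (mulrC _ (_ / _)) divfK ?gt_eqF//; lra.
Qed.

Lemma achievable_le r : achievable Z sigma rho r -> r <= awgn_rate.
Proof.
move=> [c cc]; rewrite leNgt; apply/negP => rC.
have C0 : 0 <= awgn_rate.
  by rewrite mulr_ge0// ln_ge0// lerDl divr_ge0// ltW.
(* With this choice [awgn_rate + eps] is r - eps, so the number of messages exceeds the factor of q
   by about e^(n eps). *)
pose eps := (r - awgn_rate) / 2.
have eps0 : 0 < eps by rewrite divr_gt0// subr_gt0.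
have r0 : 0 <= r by rewrite ltW// (le_lt_trans C0).
pose k := expR ((eps / (rho + nu) + eps ^+ 2 * (rho + nu)^-1 ^+ 2 * nu) / 2 * sigma).
(* The factor 2 pays for the floor: M >= 1 and M + 1 > e^(nr) give e^(nr) < 2 M. *)
pose err n : R := 2 * expR (- (n%:R * eps)) + k * expR (- (n%:R * (eps ^+ 2 / 2))).
have H n : (1 <= error_prob Z (c n) + (err n)%:E)%E.
  have M0 := num_messages_gt0 n r0.
  apply: le_trans (error_prob_converse (c n) M0 eps0) _.
  rewrite leeD2l// lee_fin lerD//; last by rewrite /tail_bound /k expRD.
  rewrite ler_pdivrMr ?ltr0n//.
  have M1 : 1 <= (num_messages n r)%:R :> R by rewrite ler1n.
  have M2 : expR (n%:R * r) < (num_messages n r)%:R + 1.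
    by rewrite natr1 /num_messages; have /andP[] := truncn_itv (expR_ge0 (n%:R * r)).
  have -> : n%:R * (awgn_rate + eps) = - (n%:R * eps) + n%:R * r by rewrite /eps; field.
  rewrite expRD [2 * _]mulrC -mulrA ler_pM2l ?expR_gt0//; lra.
have cerr : (err n)%:E @[n --> \oo] --> 0%E.
  apply: cvg_EFin; first by near=> n.
  rewrite -[X in _ --> X]addr0; apply: cvgD.
    by rewrite -[X in _ --> X](mulr0 2); apply: cvgMr; exact: cvg_expRN_natl.
  by rewrite -[X in _ --> X](mulr0 k); apply: cvgMr; apply: cvg_expRN_natl; rewrite divr_gt0// exprn_gt0.
have cs : (error_prob Z (c n) + (err n)%:E)%E @[n --> \oo] --> (0 + 0)%E.
  exact: cvgeD.
have : (1 <= (0 + 0 : \bar R))%E.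
  by apply: cvge_to_ge cs _; apply: nearW => n; exact: H.
by rewrite adde0 lee_fin ler10.
Unshelve. all: by end_near. Qed.

End converse_bound.

Theorem theorem3p2 (R : realType) (d : measure_display)
    (Omega : measurableType d) (P : probability Omega R)
    (Z : nat -> {RV P >-> measurableTypeR R}) (sigma rho nu : R)
    (sigma_ge0 : 0 <= sigma) (rho_ge0 : 0 <= rho) (nu_gt0 : 0 < nu)
    (noiseZ : awgn_noise nu Z) :
  ((2^-1)%:E * lne (1 + expeR (2%:E * volume_exponent sigma rho)
                          / (2 * pi * expR 1 * nu)%:E)
     <= capacity Z sigma rho)%E /\
  (capacity Z sigma rho <= (2^-1 * ln (1 + rho / nu))%:E)%E.
Proof.
split; last first.
  apply: ge_ereal_sup => _ [r /= ar <-]; rewrite lee_fin.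
  exact: (achievable_le sigma_ge0 rho_ge0 nu_gt0 noiseZ ar).
have cap0 : (0 <= capacity Z sigma rho)%E.
  by apply: ereal_sup_ubound; exists 0 => //; exact: achievable0.
have B0 : 0 < 2 * pi * expR 1 * nu by rewrite !mulr_gt0 ?expR_gt0 ?pi_gt0.
have [->|[w [-> volS]]] := volume_exponent_spec sigma rho.
  (* With exponent -oo the lower bound is ln 1 / 2 = 0. *)
  have -> : (2%:E * -oo = -oo :> \bar R)%E by rewrite gt0_muleNy// lte_fin.
  by rewrite [expeR _]/= mul0e adde0 lne1 mule0.
have -> : ((2^-1)%:E * lne (1 + expeR (2%:E * w%:E) / (2 * pi * expR 1 * nu)%:E))%E =
    (epi_rate nu w)%:E.
  rewrite /epi_rate -EFinM [expeR _]/= inver gt_eqF// -EFinM -EFinD lne_EFin -?EFinM//.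
  by rewrite addr_gt0// divr_gt0// expR_gt0.
(* Only rates strictly below [epi_rate] are shown achievable, so it is approached from below; if
   [epi_rate nu w - e] is not positive, rate 0 suffices. *)
apply/lee_addgt0Pr => e e0.
have [|Ce] := leP (epi_rate nu w - e) 0.
  rewrite lerBlDr add0r => Ce; rewrite -[leLHS]add0e leeD// lee_fin.
rewrite -leeBlDr// -EFinB; apply: ereal_sup_ubound; exists (epi_rate nu w - e) => //=.
apply: (achievable_epi sigma_ge0 rho_ge0 nu_gt0 noiseZ volS); first exact: ltW.
by rewrite ltrBlDr ltrDl.
Qed.
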